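(* Let $G$ be a nilpotent group with finite symmetric generating set $S$ ($S=S^{-1}$), and consider the action of $G$ on its horofunction boundary coming from the word length metric associated to $S$. Let $P:=\operatorname{conv}(\phi(S))\subset\mathbb{R}^N$, where $\phi:G\to\mathbb{Z}^N$ is the projection onto the torsion-free part of the abelianisation of $G$. Then there is a natural one-to-one correspondence between the finite orbits of Busemann points and the facets of $P$.
   Context: Word metric: $d(u,v)$ is the least $n$ such that $u^{-1}v$ is a product of $n$ elements of $S$; it is left invariant, so $G$ acts isometrically on itself by left translations. The base-point is the identity $e$. Horofunction boundary: for $z\in G$ let $\psi_z(x):=d(x,z)-d(e,z)$. The horofunction boundary is $\operatorname{cl}\{\psi_z\mid z\in G\}\setminus\{\psi_z\mid z\in G\}$, the closure being taken in the space of real-valued functions on $G$ with the topology of uniform convergence on compact (that is, finite) sets; its elements are called horofunctions. The left-translation action extends to the boundary by $(g\cdot\xi)(x)=\xi(g^{-1}x)-\xi(g^{-1})$. Busemann points: a geodesic path is a map $\gamma:\mathbb{N}\to G$ ($\mathbb{N}=\{0,1,2,\dots\}$) with $d(\gamma(s),\gamma(t))=|s-t|$ for all $s,t$. Every geodesic path converges to a point $\xi$ of the horofunction boundary, i.e. $\psi_{\gamma(t)}\to\xi$ as $t\to\infty$; a Busemann point is such a limit. Projection: the abelianisation $G/[G,G]$ is a finitely generated abelian group and so can be written $Z_0\times\mathbb{Z}^N$ with $Z_0$ finite (the torsion subgroup). The map $\phi$ sends each element of $G$ to its class in $(G/[G,G])/Z_0\cong\mathbb{Z}^N$, and $\mathbb{Z}^N$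 is considered as embedded in $\mathbb{R}^N$. A facet of a polytope is a proper face of maximal dimension, i.e. of co-dimension $1$. *)

(* Defs.v *)
From HB Require Import structures.
From mathcomp Require Import all_boot all_order all_algebra.
From mathcomp Require Import all_classical all_reals all_analysis.

Set Implicit Arguments.
Unset Strict Implicit.
Unset Printing Implicit Defensive.

Import Order.TTheory GRing.Theory Num.Theory.
Import numFieldNormedType.Exports.

Local Open Scope classical_set_scope.
Local Open Scope group_scope.
Local Open Scope ring_scope.

Section Groups.
Context {G : groupType}.
Implicit Types (A B H S : set G) (x y z g : G).

Definition subgroup H : Prop :=
  H 1%g /\ forall x y, H x -> H y -> H (x * y^-1)%g.

Definition generated A : set G := smallest subgroup A.

Definition commutator A B : set G :=
  generated [set g | exists x y, [/\ A x, B y & g = [~ x, y]%g]].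

(* [lower_central n] is the term usually written gamma_(n+1). *)
Fixpoint lower_central (n : nat) : set G :=
  if n is m.+1 then commutator (lower_central m) setT else setT.

Definition nilpotent_group : Prop := exists n, lower_central n = [set 1%g].

Definition symmetric_set S : Prop := forall s, S s -> S s^-1%g.

Definition generating_set S : Prop := generated S = setT.

Definition is_word_of S (n : nat) g : Prop :=
  exists w : 'I_n -> G, (forall i, S (w i)) /\ g = (\prod_(i < n) w i)%g.

(* The default value 0 is only taken when [g] is not a product of elements
   of [S], which does not happen for a symmetric generating set. *)
Definition word_length S g : nat :=
  xget 0%N [set n | is_word_of S n g /\
                    forall m, is_word_of S m g -> (n <= m)%N].

Definition word_dist S x y : nat := word_length S (x^-1 * y)%g.

Definition geodesic_path S (gamma : nat -> G) : Prop :=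
  forall s t : nat, word_dist S (gamma s) (gamma t) = `|s%:Z - t%:Z|%N.

(* The preimage in [G] of the torsion subgroup of the abelianisation. *)
Definition torsion_mod_commutator : set G :=
  [set g | exists n : nat, (0 < n)%N /\ commutator setT setT (g ^+ n)%g].

(* By the first isomorphism theorem, such a [phi] is the quotient map from [G]
   to its abelianisation modulo torsion, followed by an isomorphism with Z^N. *)
Definition torsion_free_abelianisation N (phi : G -> 'rV[int]_N) : Prop :=
  [/\ forall x y, phi (x * y)%g = phi x + phi y,
      range phi = setT &
      forall g, phi g = 0 <-> torsion_mod_commutator g].

End Groups.

Arguments nilpotent_group : clear implicits.

Section HorofunctionBoundary.
Context {R : realType} {G : groupType}.
Variable S : set G.

Definition psi (z : G) : G -> R :=
  fun x => (word_dist S x z)%:R - (word_dist S 1%g z)%:R.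

(* The compact subsets of the discrete space [G] are its finite subsets. *)
Definition horofunction_boundary : set (G -> R) :=
  @closure {family finite_set, G -> R} (range psi) `\` range psi.

Definition converges_to (gamma : nat -> G) (xi : G -> R) : Prop :=
  {family finite_set, (fun t => psi (gamma t)) @ \oo --> xi}.

Definition busemann_point (xi : G -> R) : Prop :=
  horofunction_boundary xi /\
  exists2 gamma, geodesic_path S gamma & converges_to gamma xi.

Definition act (g : G) (xi : G -> R) : G -> R :=
  fun x => xi (g^-1 * x)%g - xi g^-1%g.

Definition orbit (xi : G -> R) : set (G -> R) := range (act ^~ xi).

Definition finite_busemann_orbit (O : set (G -> R)) : Prop :=
  finite_set O /\ exists2 xi, busemann_point xi & O = orbit xi.

End HorofunctionBoundary.

Section Polytopes.
Context {R : realType} {N : nat}.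
Implicit Types A P F : set 'rV[R]_N.

Definition conv A : set 'rV[R]_N := smallest (@convex_set R 'rV[R]_N) A.

Definition affinely_independent k (x : 'I_k.+1 -> 'rV[R]_N) : bool :=
  row_free (\matrix_(i < k) (x (lift ord0 i) - x ord0)).

(* The empty set also gets dimension 0. *)
Definition affine_dim A : nat :=
  \max_(k < N.+1 | `[< exists x : 'I_k.+1 -> 'rV[R]_N,
                       (forall i, A (x i)) /\ affinely_independent x >]) k.

Definition face P F : Prop :=
  exists (f : {scalar 'rV[R]_N}) (c : R),
    (forall x, P x -> f x <= c) /\ F = [set x | P x /\ f x = c].

(* Faces are taken nonempty, so that a point has no proper face and no facet. *)
Definition proper_face P F : Prop := [/\ face P F, F !=set0 & F <> P].

Definition facet P F : Prop :=
  proper_face P F /\ (affine_dim F).+1 = affine_dim P.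

End Polytopes.

Section Correspondence.
Context {R : realType} {G : groupType} {N : nat}.
Variables (S : set G) (phi : G -> 'rV[int]_N).

Definition proj (g : G) : 'rV[R]_N := map_mx intr (phi g).

Definition generator_polytope : set 'rV[R]_N := conv (proj @` S).

(* The natural correspondence: [O] contains the limit of a geodesic path all
   of whose steps are generators projecting into [F]. *)
Definition orbit_of_facet (F : set 'rV[R]_N) (O : set (G -> R)) : Prop :=
  exists gamma : nat -> G,
    [/\ geodesic_path S gamma,
        forall t, F (proj ((gamma t)^-1 * gamma t.+1)%g) &
        exists2 xi, O xi & converges_to S gamma xi].

End Correspondence.

(* Main.v *)
Require Import Defs.
From HB Require Import structures.
From mathcomp Require Import all_boot all_order all_algebra.
From mathcomp Require Import all_classical all_reals all_analysis.
From mathcomp Require Import ring lra.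

(** The key is to attach to a facet [F], cut out of the polytope by [f = 1] for
    a linear functional [f], one explicit horofunction. Since [f] is at most 1 on
    the projections of the generators, [f (proj g)] is at most the length of [g];
    the elements for which equality holds form a submonoid, [cone], generated
    by the generators that project into [F]. In a nilpotent group any two elements
    of a submonoid have a common right multiple [nilpotent_common_multiple], so the
    submonoid is directed, and the functions [x |-> dist x m - len m], for [m] in
    it, decrease to a limit [cone_horofunction]. A geodesic that passes
    beyond every element of the submonoid converges to it [dominating_converges],
    and such geodesics exist [dominating_geodesic].

    Directedness also gives [xi (v * x) = xi x - len v] for [v] in the submonoid
    [cone_horofunction_mull], so the stabilizer of this horofunction [xi] contains
    the generators projecting into [F]. These span, and in a finitely generated
    nilpotent group a subgroup whose image in the abelianisation has finite index
    has finite index itself [nilpotent_power_in_subgroup, nilpotent_finite_index];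
    so the orbit of [xi] is finite. Moreover [xi + f] is bounded, which recovers
    [f], hence [F], from the orbit [facet_orbit_injective].

    Conversely, let a geodesic [gamma] converge to a point [xi] with finite orbit.
    On its stabilizer, which contains a power of every element, [xi] is a
    homomorphism to the reals. Commutators of powers being powers of
    commutators up to longer commutators, such a homomorphism vanishes on
    the part of the commutator subgroup of [G] that lies in the stabilizer
    [nilpotent_power_commutator], and therefore it is [- f] for some functional
    [f] on the abelianisation [finite_orbit_functional]. As [xi + f] is bounded and [xi (gamma t) = - t],
    all but finitely many steps of [gamma] satisfy [f = 1], and the generators
    with [f = 1] must span [facet_steps_spanning]: so [f] defines a facet. Finally
    any [w] in its submonoid has a power stabilizing [xi], which means that
    [gamma], once translated, passes beyond that power [facet_path_dominating];
    so the translate of [xi] is the horofunction of the facet. *)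

Set Implicit Arguments.
Unset Strict Implicit.
Unset Printing Implicit Defensive.

Import Order.TTheory GRing.Theory Num.Theory.
Import numFieldNormedType.Exports.

Local Open Scope classical_set_scope.

(** * Subgroups and congruence modulo a normal subgroup *)

Ltac gsimp := rewrite ?(invgM, invgK, mulgA, mulgK, mulgVK, mulVg, mulgV,
  mul1g, mulg1, invg1).

(** Membership in [lower_central] unfolds to a quantification over subgroups;
    the lock keeps it folded. *)
HB.lock Definition lcs (G : groupType) (n : nat) : set G := lower_central n.

Section SubgroupTheory.
Local Open Scope group_scope.
Context {G : groupType}.
Implicit Types (A H K L : set G) (x y z g : G).

Lemma subgroup1 H : subgroup H -> H 1. Proof. by case. Qed.

Lemma subgroupV H x : subgroup H -> H x -> H x^-1.
Proof. by move=> [H1 HB] Hx; rewrite -[_^-1]mul1g; exact: HB. Qed.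

Lemma subgroupM H x y : subgroup H -> H x -> H y -> H (x * y).
Proof.
move=> sH Hx Hy; rewrite -[y]invgK; case: (sH) => _; apply => //.
exact: subgroupV.
Qed.

Lemma subgroupX H x n : subgroup H -> H x -> H (x ^+ n).
Proof.
move=> sH Hx; elim: n => [|n IH]; first by rewrite expg0; exact: subgroup1.
by rewrite expgS; exact: subgroupM.
Qed.

Lemma subgroup_commg H x y : subgroup H -> H x -> H y -> H [~ x, y].
Proof.
move=> sH Hx Hy; rewrite commgEl conjgE.
by do !apply: subgroupM => //; apply: subgroupV.
Qed.

Lemma subgroup_generated A : subgroup (generated A).
Proof.
split=> [B [[B1 _]] _ //|x y Ax Ay B [sB AB]].
by case: (sB) => _; apply; [apply: Ax|apply: Ay].
Qed.

Lemma sub_generated A : A `<=` generated A.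
Proof. by move=> x Ax B [_]; apply. Qed.

Lemma generated_sub A H : subgroup H -> A `<=` H -> generated A `<=` H.
Proof. by move=> sH AH x; apply. Qed.

Definition normal_subgroup K :=
  subgroup K /\ forall x y, K x -> K (x ^ y).

Definition eqmod K x y := K (x^-1 * y).

Section Congruence.
Context (K : set G) (nK : normal_subgroup K).
Let sK := proj1 nK.

Lemma eqmodxx x : eqmod K x x.
Proof. by rewrite /eqmod mulVg; exact: subgroup1. Qed.

Lemma eqmod_sym x y : eqmod K x y -> eqmod K y x.
Proof. by move/(subgroupV sK); rewrite /eqmod; gsimp. Qed.

Lemma eqmod_trans y x z : eqmod K x y -> eqmod K y z -> eqmod K x z.
Proof. by move=> xy /(subgroupM sK xy); rewrite /eqmod; gsimp. Qed.

Lemma eqmodM x y z t : eqmod K x y -> eqmod K z t -> eqmod K (x * z) (y * t).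
Proof.
move=> /(proj2 nK _ z) xy /(subgroupM sK xy).
by rewrite /eqmod conjgE; gsimp.
Qed.

Lemma eqmodV x y : eqmod K x y -> eqmod K x^-1 y^-1.
Proof.
move=> /eqmod_sym /(proj2 nK _ y^-1).
by rewrite /eqmod conjgE; gsimp.
Qed.

Lemma eqmodX x y n : eqmod K x y -> eqmod K (x ^+ n) (y ^+ n).
Proof.
move=> xy; elim: n => [|n IH]; first by rewrite !expg0; exact: eqmodxx.
by rewrite !expgS; exact: eqmodM.
Qed.

Lemma eqmod_commX x y n :
  eqmod K (y * x) (x * y) -> eqmod K (y * x ^+ n) (x ^+ n * y).
Proof.
move=> xy; elim: n => [|n IH].
  by rewrite !expg0 mulg1 mul1g; exact: eqmodxx.
rewrite expgS mulgA.
apply: (eqmod_trans (eqmodM xy (eqmodxx _))); rewrite -!mulgA.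
exact: eqmodM (eqmodxx _) IH.
Qed.

Lemma eqmod_expM x y n :
  eqmod K (y * x) (x * y) -> eqmod K ((x * y) ^+ n) (x ^+ n * y ^+ n).
Proof.
move=> xy; elim: n => [|n IH].
  by rewrite !expg0 mulg1; exact: eqmodxx.
rewrite [(x * y) ^+ n.+1]expgS.
apply: (eqmod_trans (eqmodM (eqmodxx _) IH)).
rewrite [x ^+ n.+1]expgS [y ^+ n.+1]expgS -!mulgA; apply: eqmodM (eqmodxx _) _.
rewrite !mulgA; apply: eqmodM _ (eqmodxx _); exact: eqmod_commX.
Qed.

Lemma eqmod_centralE z x : eqmod K (x * z) (z * x) = K [~ z, x].
Proof. by rewrite /eqmod commgEl conjgE; gsimp. Qed.

Lemma eqmod_central z x : K [~ z, x] -> eqmod K (x * z) (z * x).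
Proof. by rewrite eqmod_centralE. Qed.

Lemma eqmod_commgX x y m :
  K [~ [~ x, y], x] -> eqmod K [~ x ^+ m, y] ([~ x, y] ^+ m).
Proof.
move=> Kc; rewrite commgEl conjXg.
have -> : x ^ y = x * [~ x, y] by rewrite commgEl mulgA mulgV mul1g.
rewrite -[X in eqmod _ _ X](mulKg (x ^+ m)).
apply: eqmodM (eqmodxx _) _; apply: eqmod_expM.
exact/eqmod_sym/eqmod_central.
Qed.

(** Modulo [K], conjugation by [y] multiplies [x] by a central element, so it
    multiplies [x ^+ m] by the [m]-th power of that element; hence the
    commutator is bilinear. *)
Lemma eqmod_commgXX x y m n : (forall z, K [~ [~ x, y], z]) ->
  eqmod K [~ x ^+ m, y ^+ n] ([~ x, y] ^+ (m * n)).
Proof.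
move=> Kc; have cm : eqmod K [~ x ^+ m, y] ([~ x, y] ^+ m).
  exact: eqmod_commgX.
rewrite expgnA -[[~ x ^+ m, _]]invgR -[X in eqmod K _ X]invgK; apply: eqmodV.
have cm' : eqmod K [~ y, x ^+ m] ([~ x, y] ^- m).
  by rewrite -invgR; exact: eqmodV.
rewrite -expVgn; apply: eqmod_trans (eqmodX _ cm'); apply: eqmod_commgX.
have ey : eqmod K (y * [~ x, y] ^+ m) ([~ x, y] ^+ m * y).
  exact/eqmod_commX/eqmod_central.
have ey' : eqmod K (y * [~ x, y] ^- m) ([~ x, y] ^- m * y).
  have := eqmodM (eqmodxx ([~ x, y] ^- m)) (eqmodM ey (eqmodxx ([~ x, y] ^- m))).
  by gsimp => /eqmod_sym.
rewrite -eqmod_centralE; apply: eqmod_trans (eqmodM (eqmodxx y) cm') _.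
exact: eqmod_trans ey' (eqmodM (eqmod_sym cm') (eqmodxx y)).
Qed.

End Congruence.

(** As [K] is normal, this is the product [L K], or [L] read modulo [K]. *)
Definition product_set L K : set G := [set x | exists2 l, L l & eqmod K l x].

Lemma subgroup_product L K :
  subgroup L -> normal_subgroup K -> subgroup (product_set L K).
Proof.
move=> sL nK; split; first by exists 1; [exact: subgroup1|exact: eqmodxx].
move=> x y [l Ll lx] [l' Ll' ly]; exists (l * l'^-1).
  by apply: subgroupM => //; exact: subgroupV.
by apply: eqmodM => //; exact: eqmodV.
Qed.

Lemma product_set_eqmod L K x y : normal_subgroup K ->
  eqmod K x y -> product_set L K x -> product_set L K y.
Proof. by move=> nK xy [l Ll lx]; exists l => //; exact: eqmod_trans xy. Qed.

Lemma product_setl L K : normal_subgroup K -> L `<=` product_set L K.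
Proof. by move=> nK x Lx; exists x => //; exact: eqmodxx. Qed.

Lemma product_set1 L : product_set L [set 1] = L.
Proof.
apply/seteqP; split=> x /=; last by move=> Lx; exists x => //; rewrite /eqmod mulVg.
by move=> [l Ll]; rewrite /eqmod /= => /mulg1_eq; rewrite invgK => <-.
Qed.

(** * The lower central series *)

Local Notation gam := (@lcs G).

Lemma lcsE n : gam n = lower_central n. Proof. by rewrite unlock. Qed.

Lemma lcs1 : gam 1 = commutator setT setT. Proof. exact: lcsE. Qed.

Lemma lcs_commg n x y : gam n x -> gam n.+1 [~ x, y].
Proof. by rewrite unlock => gx; apply: sub_generated; exists x, y. Qed.

Lemma lcs_ind n (H : set G) : subgroup H ->
  (forall x y, gam n x -> H [~ x, y]) -> gam n.+1 `<=` H.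
Proof.
rewrite unlock => sH h; apply: generated_sub => // _ [x [y [gx _ ->]]].
exact: h.
Qed.

Lemma normal_lcs n : normal_subgroup (gam n).
Proof.
elim: n => [|n [sn nn]]; first by rewrite unlock; split.
have sg : subgroup (gam n.+1) by rewrite unlock; exact: subgroup_generated.
split=> // x z gx; move: x gx; apply: lcs_ind.
  split; first by rewrite /= conj1g; exact: subgroup1.
  move=> x y gx gy; rewrite /= conjMg conjVg.
  by apply: subgroupM => //; exact: subgroupV.
by move=> x y gx; rewrite /= conjRg; apply: lcs_commg; exact: nn.
Qed.
#[local] Hint Resolve normal_lcs : core.

Lemma subgroup_lcs n : subgroup (gam n).
Proof. exact: (normal_lcs n).1. Qed.
#[local] Hint Resolve subgroup_lcs : core.

Lemma lcsS n : gam n.+1 `<=` gam n.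
Proof.
apply: lcs_ind => // x y gx; rewrite commgEl.
apply: subgroupM => //; first exact: subgroupV.
exact: (normal_lcs n).2.
Qed.

(** Since [gam i] is central modulo [gam i.+1], the factors taken from it do
    not affect commutators modulo [gam i.+1]. *)
Lemma product_commg L i x y : subgroup L ->
  product_set L (gam i) x -> product_set L (gam i) y ->
  product_set L (gam i.+1) [~ x, y].
Proof.
move=> sL [l Ll lx] [l' Ll' ly].
exists [~ l, l']; first exact: subgroup_commg.
have nK := normal_lcs i.+1.
have central z g : gam i z -> eqmod (gam i.+1) (g * z) (z * g).
  by move=> gz; apply: eqmod_central; exact: lcs_commg.
have eqm a b p q : gam i p ->
    eqmod (gam i.+1) ((a * p) * (b * q)) (a * b * (p * q)).
  move=> gp; rewrite -[a * p * _]mulgA -[a * b * _]mulgA.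
  apply: (eqmodM nK (eqmodxx nK _)); rewrite [p * (b * q)]mulgA [b * (p * q)]mulgA.
  apply: (eqmodM nK _ (eqmodxx nK _)).
  by apply: (eqmod_sym nK); apply: central.
have xy := eqm l l' _ (l'^-1 * y) lx; have yx := eqm l' l _ (l^-1 * x) ly.
set c := l^-1 * x in lx xy yx; set d := l'^-1 * y in ly xy yx.
have cE : l * c = x by rewrite mulVKg.
have dE : l' * d = y by rewrite mulVKg.
rewrite cE dE in xy yx.
have cd : eqmod (gam i.+1) (y * x) (l' * l * (c * d)).
  apply: (eqmod_trans nK yx); apply: (eqmodM nK (eqmodxx nK _)).
  exact: central.
have -> : [~ x, y] = (y * x)^-1 * (x * y) by rewrite commgEl conjgE; gsimp.
apply: (eqmod_sym nK); apply: (eqmod_trans nK (eqmodM nK (eqmodV nK cd) xy)).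
have -> : (l' * l * (c * d))^-1 * (l * l' * (c * d)) = [~ l, l'] ^ (c * d).
  by rewrite commgEl !conjgE; gsimp.
rewrite conjgE; apply: (eqmod_trans nK (y := (c * d)^-1 * ((c * d) * [~ l, l']))).
  apply: (eqmodM nK (eqmodxx nK _)); apply: central.
  exact: subgroupM.
by rewrite mulKg; exact: eqmodxx.
Qed.

(** ** Powers of elements and subgroups of nilpotent groups *)

(** The elements of [gam i] some power of which lies in [L gam i.+1] form a
    subgroup, as [gam i] is abelian modulo [gam i.+1]; so it is enough to treat
    the generating commutators, by bilinearity. *)
Lemma power_in_next_product L i : subgroup L ->
  (forall x y, gam i x -> exists m n, [/\ 0 < m, 0 < n &
     product_set L (gam i.+2) [~ x ^+ m, y ^+ n]]%N) ->
  forall c, gam i.+1 c -> exists2 m, (0 < m)%N & product_set L (gam i.+2) (c ^+ m).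
Proof.
move=> sL h; have nK := normal_lcs i.+2.
have sLK := subgroup_product sL nK.
pose A := [set c | gam i.+1 c /\
   exists2 m, (0 < m)%N & product_set L (gam i.+2) (c ^+ m)].
suff gA : gam i.+1 `<=` A by move=> c /gA [].
apply: lcs_ind.
  split.
    by split; [exact: subgroup1|exists 1%N; rewrite // expg1; exact: subgroup1].
  move=> x y [gx [m m0 Lm]] [gy [n n0 Ln]].
  have gyV : gam i.+1 y^-1 by exact: subgroupV.
  split; first exact: subgroupM.
  exists (m * n)%N; rewrite ?muln_gt0 ?m0 //.
  have e : eqmod (gam i.+2) (y^-1 * x) (x * y^-1).
    by apply: eqmod_central; exact: lcs_commg.
  apply: (product_set_eqmod nK (eqmod_sym nK (eqmod_expM nK (m * n)%N e))).
  apply: subgroupM => //; first by rewrite expgnA; exact: subgroupX.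
  by rewrite mulnC expgnA expVgn expVgn; apply: subgroupV => //; exact: subgroupX.
move=> x y gx; split; first exact: lcs_commg.
have [m [n [m0 n0 Lmn]]] := h x y gx.
exists (m * n)%N; rewrite ?muln_gt0 ?m0 //.
apply: product_set_eqmod Lmn => //; apply: eqmod_commgXX => // z.
exact/lcs_commg/lcs_commg.
Qed.

Lemma power_product_step L i g : subgroup L ->
  (forall c, gam i c -> exists2 m, (0 < m)%N & product_set L (gam i.+1) (c ^+ m)) ->
  (exists2 m, (0 < m)%N & product_set L (gam i) (g ^+ m)) ->
  exists2 m, (0 < m)%N & product_set L (gam i.+1) (g ^+ m).
Proof.
move=> sL h [m m0 [l Ll lg]]; have nK := normal_lcs i.+1.
have sLK := subgroup_product sL nK.
have [n n0 Ln] := h _ lg; exists (m * n)%N; first by rewrite muln_gt0 m0.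
rewrite expgnA -[g ^+ m](mulVKg l).
have e : eqmod (gam i.+1) (l^-1 * g ^+ m * l) (l * (l^-1 * g ^+ m)).
  by apply: (eqmod_sym nK); apply: eqmod_central; exact: lcs_commg.
apply: (product_set_eqmod nK (eqmod_sym nK (eqmod_expM nK n e))).
by apply: subgroupM => //; apply: product_setl => //; exact: subgroupX.
Qed.

(** The hypothesis descends along the lower central series, since a power of a
    commutator is a commutator of powers modulo the next term. *)
Lemma nilpotent_power_in_subgroup L : nilpotent_group G -> subgroup L ->
  (forall g, exists2 m, (0 < m)%N & product_set L (gam 1) (g ^+ m)) ->
  forall g, exists2 m, (0 < m)%N & L (g ^+ m).
Proof.
move=> [c]; rewrite -lcsE => gc1 sL h1.
suff h i : forall g, exists2 m, (0 < m)%N & product_set L (gam i.+1) (g ^+ m).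
  move=> g; have [m m0 Lm] := h c g; exists m => //.
  rewrite -(product_set1 L) -gc1; case: Lm => l Ll lg; exists l => //.
  exact: lcsS lg.
elim: i => [//|i IH] g; apply: power_product_step (IH g) => //.
apply: power_in_next_product => // x y gx.
have [m m0 Lm] := IH x; have [n n0 Ln] := IH y.
by exists m, n; split => //; exact: product_commg.
Qed.

(** If [H] contains a power of every element, [~ x, y] ^+ (m * n) is, to first
    order, the commutator of two elements of [H]. *)
Lemma nilpotent_power_commutator H L : nilpotent_group G -> subgroup L ->
  (forall g, exists2 m, (0 < m)%N & H (g ^+ m)) ->
  (forall x y, H x -> H y -> L [~ x, y]) ->
  forall c, gam 1 c -> exists2 m, (0 < m)%N & L (c ^+ m).
Proof.
move=> [k]; rewrite -lcsE => gk1 sL hH hL c g1c.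
suff h i : exists2 m, (0 < m)%N & product_set L (gam i.+1) (c ^+ m).
  have [m m0 Lm] := h k; exists m => //.
  rewrite -(product_set1 L) -gk1; case: Lm => l Ll lg; exists l => //.
  exact: lcsS lg.
elim: i => [|i IH].
  exists 1%N => //; exists 1; first exact: subgroup1.
  by rewrite /eqmod invg1 mul1g.
apply: power_product_step IH => //; apply: power_in_next_product => // x y _.
have [m m0 Hm] := hH x; have [n n0 Hn] := hH y.
by exists m, n; split => //; apply: product_setl => //; exact: hL.
Qed.

End SubgroupTheory.

Local Notation gam := (@lcs _).

(** * Subgroups of finite index in nilpotent groups *)

Section FiniteIndex.
Local Open Scope group_scope.
Context {G : groupType}.
Implicit Types (A B H K L M S T : set G) (x y z g : G).

Inductive products T : set G :=
| products1 : products T 1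
| products_cons t x : T t -> products T x -> products T (t * x).

Lemma productsM T x y : products T x -> products T y -> products T (x * y).
Proof.
elim=> [|t z Tt _ IH] Ty; first by rewrite mul1g.
by rewrite -mulgA; apply: products_cons => //; exact: IH.
Qed.

Lemma products_gen T t : T t -> products T t.
Proof.
by move=> Tt; rewrite -[t]mulg1; apply: products_cons => //; exact: products1.
Qed.

Lemma products_sub T H : subgroup H -> T `<=` H -> products T `<=` H.
Proof.
move=> sH TH x; elim=> [|t y Tt _ Hy]; first exact: subgroup1.
by apply: subgroupM => //; exact: TH.
Qed.

Lemma products_generated S :
  symmetric_set S -> generating_set S -> forall g, products S g.
Proof.
move=> Ssym Sgen g; have : generated S g by rewrite Sgen.
move: g; apply: generated_sub; last by move=> s; exact: products_gen.
split=> [|x y Sx Sy]; first exact: products1.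
apply: productsM => //; elim: Sy => [|t z St _ IH].
  by rewrite invg1; exact: products1.
by rewrite invgM; apply: productsM => //; apply: products_gen; exact: Ssym.
Qed.

Definition coset_representatives M L B :=
  forall x, M x -> exists2 b, B b & L (x * b^-1).

Section AbelianQuotient.
Context (M L : set G) (sM : subgroup M) (sL : subgroup L) (LM : L `<=` M).
Hypothesis ML : forall x y, M x -> M y -> L [~ x, y].
Hypothesis powL : forall x, M x -> exists2 m, (0 < m)%N & L (x ^+ m).

Let sim x y := L (x * y^-1).

Let sim_trans y x z : sim x y -> sim y z -> sim x z.
Proof. by move=> xy /(subgroupM sL xy); rewrite /sim; gsimp. Qed.

Let sim_mull a x y : M a -> M x -> M y -> sim x y -> sim (a * x) (a * y).
Proof.
move=> Ma Mx My xy.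
have := subgroupM sL (ML (subgroupV sM Ma) (subgroupV sM (LM xy))) xy.
by rewrite /sim commgEl conjgE; gsimp.
Qed.

Let sim_comm x y : M x -> M y -> sim (x * y) (y * x).
Proof.
move=> Mx My; have := ML (subgroupV sM Mx) (subgroupV sM My).
by rewrite /sim commgEl conjgE; gsimp.
Qed.

(** A finitely generated abelian torsion group is finite: gathering the powers
    of each generator puts a product in normal form. *)
Lemma finite_abelian_quotient T : finite_set T -> T `<=` M ->
  exists B, [/\ finite_set B, B `<=` M & coset_representatives (products T) L B].
Proof.
move=> /finite_seqP[s ->]; elim: s => [_|t s IH tsM].
  exists [set 1]; split; [exact: finite_set1|by move=> _ ->; exact: subgroup1|].
  move=> x; case=> [|? ? //]; exists 1 => //.
  by rewrite mulgV; exact: subgroup1.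
have Mt : M t by apply: tsM; rewrite /= mem_head.
have sMs : [set` s] `<=` M by move=> x /= xs; apply: tsM; rewrite /= inE xs orbT.
have [B [finB BM sB]] := IH sMs.
have [m m0 Lm] := powL Mt.
have MX n : M (t ^+ n) by exact: subgroupX.
have Mprod y : products [set` s] y -> M y by exact: products_sub.
exists [set t ^+ a * b | a in `I_m & b in B]; split.
- exact: finite_image2.
- by move=> _ [a _] [b Bb] <-; apply: subgroupM => //; exact: BM.
move=> x px.
have [n [y [py xy]]] : exists n y, products [set` s] y /\ sim x (t ^+ n * y).
  elim: px => [|u z /= us pz [n [y [py zy]]]].
    exists 0%N, 1; split; first exact: products1.
    by rewrite /sim expg0 mulg1 mulgV; exact: subgroup1.
  have Mz : M z by apply: products_sub pz.
  have Mu : M u by exact: tsM.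
  have My := Mprod _ py.
  have := sim_mull Mu Mz (subgroupM sM (MX n) My) zy.
  move: us; rewrite inE => /orP[/eqP ->|us].
    by rewrite mulgA -expgS => h; exists n.+1, y.
  move=> h; exists n, (u * y); split; first exact: products_cons.
  apply: sim_trans h _; rewrite [u * (_ * y)]mulgA mulgA.
  by have := sim_comm Mu (MX n); rewrite /sim; gsimp.
have [b Bb yb] := sB y py.
exists (t ^+ (n %% m) * b).
  by exists (n %% m)%N; [rewrite /= ltn_mod|exists b].
apply: sim_trans xy _.
apply: sim_trans (sim_mull (MX n) (Mprod _ py) (BM _ Bb) yb) _.
rewrite /sim {1}(divn_eq n m) expgnDr mulnC expgnA; gsimp.
exact: subgroupX.
Qed.

End AbelianQuotient.

(** Schreier's lemma: rewriting a product letter by letter, keeping track of the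
    coset reached so far, expresses it through the elements [b * t * b'^-1] of
    [L]. *)
Lemma schreier M L T B : subgroup M -> subgroup L -> L `<=` M ->
  finite_set T -> T `<=` M -> M `<=` products T ->
  finite_set B -> B `<=` M -> coset_representatives M L B ->
  exists T', [/\ finite_set T', T' `<=` L & L `<=` products T'].
Proof.
move=> sM sL LM finT TM MT finB BM rB.
pose B1 := B `|` [set 1].
have finB1 : finite_set B1 by rewrite finite_setU; split => //; exact: finite_set1.
pose T' := [set b * u | b in B1 & u in
  [set t * b'^-1 | t in T & b' in B1] `|` [set 1]] `&` L.
have T'L : T' `<=` L by move=> x [].
exists T'; split => //.
  apply: finite_setIl; apply: finite_image2 => //; rewrite finite_setU.
  by split; [exact: finite_image2|exact: finite_set1].
have rewr x : products T x -> forall b, B1 b -> M b ->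
    exists2 b', B1 b' & products T' (b * x * b'^-1).
  elim=> [|t y Tt _ IH] b B1b Mb.
    by exists b => //; rewrite mulg1 mulgV; exact: products1.
  have [c Bc Lc] := rB (b * t) (subgroupM sM Mb (TM _ Tt)).
  have [b' Bb' h] := IH c (or_introl Bc) (BM _ Bc).
  exists b' => //.
  have -> : b * (t * y) * b'^-1 = (b * t * c^-1) * (c * y * b'^-1) by gsimp.
  apply: productsM h; apply: products_gen; split => //.
  exists b => //; exists (t * c^-1); last by rewrite mulgA.
  by left; exists t => //; exists c => //; left.
move=> x Lx.
have [b Bb h] := rewr x (MT x (LM x Lx)) 1 (or_intror erefl) (subgroup1 sM).
rewrite mul1g in h; rewrite -(mulgVK b x); apply: (productsM h).
apply: products_gen; split; first by exists b => //; exists 1; [right|rewrite mulg1].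
have := subgroupM sL (subgroupV sL (products_sub sL T'L h)) Lx.
by gsimp.
Qed.

(** The chain of the subgroups [L gam i] goes from [G] down to [L]; each is
    finitely generated and has an abelian torsion, hence finite, quotient by the
    next one. *)
Lemma nilpotent_finite_index L S : nilpotent_group G -> subgroup L ->
  finite_set S -> (forall g, products S g) ->
  (forall g, exists2 m, (0 < m)%N & L (g ^+ m)) ->
  exists2 B, finite_set B & coset_representatives setT L B.
Proof.
move=> [c]; rewrite -lcsE => gc1 sL finS genS powL.
have sLi i : subgroup (product_set L (gam i)).
  by apply: subgroup_product => //; exact: normal_lcs.
suff h i : (exists T, [/\ finite_set T, T `<=` product_set L (gam i) &
      product_set L (gam i) `<=` products T]) /\
    exists2 B, finite_set B & coset_representatives setT (product_set L (gam i)) B.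
  by have [_] := h c; rewrite gc1 product_set1.
elim: i => [|i [[T [finT TM MT]] [B finB rB]]].
  have L0 x : product_set L (gam 0) x.
    by exists 1; [exact: subgroup1|rewrite lcsE].
  split; first by exists S; split.
  by exists [set 1]; [exact: finite_set1|move=> x _; exists 1].
have LM : product_set L (gam i.+1) `<=` product_set L (gam i).
  by move=> x [l Ll lx]; exists l => //; exact: lcsS.
have ML x y : product_set L (gam i) x -> product_set L (gam i) y ->
    product_set L (gam i.+1) [~ x, y] by exact: product_commg.
have pow x : product_set L (gam i) x ->
    exists2 m, (0 < m)%N & product_set L (gam i.+1) (x ^+ m).
  move=> _; have [m m0 Lm] := powL x; exists m => //.
  by apply: product_setl => //; exact: normal_lcs.
have [B' [finB' B'M rB']] :=
  finite_abelian_quotient (sLi i) (sLi i.+1) LM ML pow finT TM.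
have rB'' : coset_representatives (product_set L (gam i))
    (product_set L (gam i.+1)) B'.
  by move=> x /MT; exact: rB'.
split; first exact: schreier (sLi i) (sLi i.+1) LM finT TM MT finB' B'M rB''.
exists [set b' * b | b' in B' & b in B]; first exact: finite_image2.
move=> x _; have [b Bb xb] := rB x I; have [b' Bb' h] := rB'' _ xb.
exists (b' * b); first by exists b' => //; exists b.
by rewrite invgM mulgA.
Qed.

(** * Common multiples in submonoids of nilpotent groups *)

(** For [x_(n+1) = x_n y_n] and [y_(n+1) = y_n x_n], the quotient
    [x_(n+1) y_(n+1)^-1] is a commutator with [x_n y_n^-1], so that the two
    sequences merge at the nilpotency class. *)
Lemma nilpotent_common_multiple M a b : nilpotent_group G ->
  (forall x y, M x -> M y -> M (x * y)) -> M 1 -> M a -> M b ->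
  exists c d, [/\ M c, M d & a * c = b * d].
Proof.
move=> [k]; rewrite -lcsE => gk1 MM M1 Ma Mb.
suff h n : exists c d, [/\ M c, M d & gam n (a * c * (b * d)^-1)].
  have [c [d [Mc Md]]] := h k; rewrite gk1 => /divg1_eq cd.
  by exists c, d.
elim: n => [|n [c [d [Mc Md g]]]]; first by exists 1, 1; split; rewrite ?lcsE.
exists (c * (b * d)), (d * (a * c)); split.
- exact/MM/MM.
- exact/MM/MM.
have := lcs_commg (b * d)^-1 (subgroupV (subgroup_lcs n) g).
by rewrite commgEl conjgE; gsimp.
Qed.

End FiniteIndex.

Local Notation orbit := Defs.orbit.

(** * The word metric *)

Section WordMetric.
Local Open Scope group_scope.
Context {G : groupType} (S : set G).
Hypotheses (Ssym : symmetric_set S) (Sgen : generating_set S).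
Implicit Types (s x y z g h : G) (n m : nat).

Local Notation len := (word_length S).
Local Notation dist := (word_dist S).

Lemma is_word_of0 g : is_word_of S 0 g <-> g = 1.
Proof.
split=> [[w [_ ->]]|->]; first by rewrite big_ord0.
by exists (fun=> 1); split; [case|rewrite big_ord0].
Qed.

Lemma is_word_ofS n g :
  is_word_of S n.+1 g <-> exists s h, [/\ S s, is_word_of S n h & g = s * h].
Proof.
split=> [[w [Sw ->]]|[s [h [Ss [w [Sw ->]] ->]]]].
  exists (w ord0), (\prod_(i < n) w (lift ord0 i)); split => //.
    by exists (w \o lift ord0); split => //= i; exact: Sw.
  by rewrite big_ord_recl.
exists (fun i => oapp w s (unlift ord0 i)); split.
  by move=> i; case: unliftP => [j|] _ /=.
rewrite big_ord_recl unlift_none /=; congr (_ * _).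
by apply: eq_bigr => i _; rewrite liftK.
Qed.

Lemma is_word_ofM n m g h :
  is_word_of S n g -> is_word_of S m h -> is_word_of S (n + m) (g * h).
Proof.
elim: n g => [|n IH] g; first by move=> /is_word_of0 ->; rewrite mul1g.
move=> /is_word_ofS[s [k [Ss wk ->]]] wh; rewrite addSn; apply/is_word_ofS.
by exists s, (k * h); rewrite mulgA; split => //; exact: IH.
Qed.

Lemma is_word_of1 s : S s -> is_word_of S 1 s.
Proof.
move=> Ss; apply/is_word_ofS; exists s, 1; rewrite mulg1; split => //.
exact/is_word_of0.
Qed.

Lemma is_word_ofV n g : is_word_of S n g -> is_word_of S n g^-1.
Proof.
elim: n g => [|n IH] g.
  by move=> /is_word_of0 ->; rewrite invg1; exact/is_word_of0.
move=> /is_word_ofS[s [h [Ss wh ->]]]; rewrite invgM -addn1.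
by apply: is_word_ofM; [exact: IH|apply/is_word_of1/Ssym].
Qed.

Lemma word_lengthP g :
  is_word_of S (len g) g /\ forall m, is_word_of S m g -> (len g <= m)%N.
Proof.
have [n wn] : exists n, is_word_of S n g.
  elim: (products_generated Ssym Sgen g) => [|s h Ss _ [n wn]].
    by exists 0%N; exact/is_word_of0.
  by exists n.+1; apply/is_word_ofS; exists s, h.
have exn : exists n, `[< is_word_of S n g >] by exists n; exact/asboolP.
rewrite /word_length.
case: xgetP => [k _ //|/(_ (ex_minn exn))]; case: ex_minnP => k /asboolP wk mink.
by case; split => // m wm; apply: mink; exact/asboolP.
Qed.

Lemma word_length_word g : is_word_of S (len g) g.
Proof. exact: (word_lengthP g).1. Qed.

Lemma word_length_le n g : is_word_of S n g -> (len g <= n)%N.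
Proof. exact: (word_lengthP g).2. Qed.

Lemma word_length1 : len 1 = 0%N.
Proof. by apply/eqP; rewrite -leqn0; apply: word_length_le; exact/is_word_of0. Qed.

Lemma word_length_gen s : S s -> (len s <= 1)%N.
Proof. by move=> Ss; apply: word_length_le; exact: is_word_of1. Qed.

Lemma word_lengthM x y : (len (x * y) <= len x + len y)%N.
Proof. by apply/word_length_le/is_word_ofM; exact: word_length_word. Qed.

Lemma word_lengthV x : len x^-1 = len x.
Proof.
apply/eqP; rewrite eqn_leq; apply/andP; split.
  by apply/word_length_le/is_word_ofV; exact: word_length_word.
rewrite -[leqLHS](congr1 len (invgK x)).
by apply/word_length_le/is_word_ofV; exact: word_length_word.
Qed.

Lemma word_lengthX x n : (len (x ^+ n) <= n * len x)%N.
Proof.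
elim: n => [|n IH]; first by rewrite expg0 word_length1.
by rewrite expgS mulSn (leq_trans (word_lengthM _ _))// leq_add2l.
Qed.

Lemma word_length_gt0 n g : len g = n.+1 ->
  exists s h, [/\ S s, len h = n & g = s * h].
Proof.
move=> lg; have := word_length_word g; rewrite lg => /is_word_ofS[s [h [Ss wh gE]]].
exists s, h; split => //; apply/eqP; rewrite eqn_leq word_length_le//=.
rewrite -ltnS -lg gE (leq_trans (word_lengthM _ _))// -add1n leq_add2r.
exact: word_length_gen.
Qed.

Lemma word_length1_gen g : len g = 1%N -> S g.
Proof.
move=> lg; have := word_length_word g; rewrite lg => /is_word_ofS[s [h [Ss]]].
by move=> /is_word_of0 -> ->; rewrite mulg1.
Qed.

Lemma word_dist_mull g x y : dist (g * x) (g * y) = dist x y.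
Proof. by rewrite /word_dist invgM mulgA mulgVK. Qed.

Lemma word_dist1 x : dist 1 x = len x.
Proof. by rewrite /word_dist invg1 mul1g. Qed.

Lemma word_distC x y : dist x y = dist y x.
Proof. by rewrite /word_dist -word_lengthV invgM invgK. Qed.

Lemma word_dist_triangle y x z : (dist x z <= dist x y + dist y z)%N.
Proof.
rewrite /word_dist; have -> : x^-1 * z = x^-1 * y * (y^-1 * z) by gsimp.
exact: word_lengthM.
Qed.

Lemma word_ball_finite n : finite_set S -> finite_set [set g | len g <= n]%N.
Proof.
move=> finS; elim: n => [|n IH].
  apply: (sub_finite_set (B := [set 1])) (finite_set1 _) => g /=.
  rewrite leqn0 => /eqP lg; have := word_length_word g.
  by rewrite lg => /is_word_of0.
apply: (sub_finite_set (B := [set g | len g <= n]%N `|`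
   [set s * h | s in S & h in [set g | len g <= n]%N])).
  move=> g /=; rewrite leq_eqVlt => /orP[/eqP lg|]; last by left.
  right; have [s [h [Ss lh ->]]] := word_length_gt0 lg.
  by exists s => //; exists h => //=; rewrite lh.
by rewrite finite_setU; split => //; exact: finite_image2.
Qed.

Lemma geodesic_dist gamma (s t : nat) : geodesic_path S gamma -> (s <= t)%N ->
  dist (gamma s) (gamma t) = (t - s)%N.
Proof. by move=> -> st; rewrite distnEr. Qed.

Lemma geodesic_step gamma t : geodesic_path S gamma ->
  S ((gamma t)^-1 * gamma t.+1).
Proof.
move=> geo; apply: word_length1_gen.
by rewrite -/(word_dist S _ _) geodesic_dist// subSnn.
Qed.

End WordMetric.

(** * Horofunctions *)

Section Horofunctions.
Local Open Scope ring_scope.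
Context {R : realType} {G : groupType} (S : set G).
Implicit Types (xi : G -> R) (gamma : nat -> G) (g h x y : G).

Lemma psiE (z x : G) : psi S z x = (word_dist S x z)%:R - (word_dist S 1%g z)%:R :> R.
Proof. by []. Qed.

(** Convergence is eventual equality at each point, as the functions [psi z]
    take integer values. *)
Lemma converges_toP gamma xi : converges_to S gamma xi <->
  forall x, exists T, forall t, (T <= t)%N -> psi S (gamma t) x = xi x.
Proof.
split.
  move=> /fam_cvgP cvg x.
  have := cvg [set x] (finite_set1 _); rewrite uniform_set1.
  move=> /cvgrPdist_lt /(_ (2^-1)); rewrite invr_gt0 ltr0n => /(_ isT).
  move=> [T _ hT]; exists T => t Tt.
  have close s : (T <= s)%N -> psi S (gamma s) x = psi S (gamma T) x :> R.
    move=> Ts; have := hT s Ts; have := hT T (leqnn T).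
    rewrite /= => h1 h2.
    have : `|psi S (gamma s) x - psi S (gamma T) x : R| < 1.
      rewrite -(subrKA (xi x)) (le_lt_trans (ler_normD _ _))//.
      by rewrite distrC [1]splitr div1r ltrD.
    rewrite !psiE.
    set a := word_dist S x _; set b := word_dist S _ _.
    set c := word_dist S x _; set d := word_dist S _ _.
    have -> : a%:R - b%:R - (c%:R - d%:R) = (a%:Z - b%:Z - (c%:Z - d%:Z))%:~R :> R.
      by rewrite !rmorphB.
    rewrite -intr_norm -[1]/(1%:~R) ltr_int => h.
    apply/eqP; rewrite -subr_eq0.
    have -> : a%:R - b%:R - (c%:R - d%:R) = (a%:Z - b%:Z - (c%:Z - d%:Z))%:~R :> R.
      by rewrite !rmorphB.
    by move: h; rewrite intr_eq0 -abszE ltz_nat ltnS leqn0 absz_eq0.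
  have lim1 : (fun s => psi S (gamma s) x) @ \oo --> (psi S (gamma t) x : R).
    apply: cvg_near_cst; exists T => // s /= Ts.
    by rewrite (close s)// (close t).
  have lim2 : (fun s => psi S (gamma s) x) @ \oo --> xi x.
    by have := cvg [set x] (finite_set1 _); rewrite uniform_set1.
  exact: (cvg_unique _ lim1 lim2).
move=> h; apply/fam_cvgP => A finA.
have [T hT] : exists T, forall t, (T <= t)%N ->
    forall x, A x -> psi S (gamma t) x = xi x.
  move: finA => /finite_seqP[s ->]; elim: s => [|y s [T hT]].
    by exists 0%N => t _ x; rewrite /= in_nil.
  have [T' hT'] := h y; exists (maxn T T') => t; rewrite geq_max => /andP[Tt T't] x.
  by rewrite /= inE => /orP[/eqP ->|xs]; [exact: hT'|exact: hT].
move=> P /uniform_nbhs[E [entE EP]].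
exists T => // t /= Tt; apply: EP => y Ay /=.
by rewrite hT//; exact: entourage_refl.
Qed.

Lemma converges_to_boundary gamma xi : converges_to S gamma xi ->
  (forall z, psi S z <> xi) -> horofunction_boundary S xi.
Proof.
move=> cvg notpsi; split; last by move=> [z _]; exact: notpsi.
move=> B nB; have [T _ hT] := cvg B nB.
by exists (psi S (gamma T)); split; [exists (gamma T)|exact: hT (leqnn T)].
Qed.

(** ** The action on functions *)

Lemma act1 xi : xi 1%g = 0 -> act 1%g xi = xi.
Proof. by move=> xi1; apply/funext => x; rewrite /act invg1 mul1g xi1 subr0. Qed.

Lemma actM g h xi : act g (act h xi) = act (g * h)%g xi.
Proof.
by apply/funext => x; rewrite /act invgM !mulgA opprB addrA subrK.
Qed.

Lemma orbit_act g xi : orbit (act g xi) = orbit xi.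
Proof.
apply/seteqP; split=> _ [h _ <-]; first by exists (h * g)%g; rewrite // -actM.
by exists (h * g^-1)%g => //; rewrite actM mulgVK.
Qed.

Lemma orbit_refl xi : xi 1%g = 0 -> orbit xi xi.
Proof. by move=> xi1; exists 1%g => //; exact: act1. Qed.

Lemma orbit_eq xi eta : orbit xi eta -> orbit eta = orbit xi.
Proof. by move=> [g _ <-]; exact: orbit_act. Qed.

Definition stabilizer xi : set G := [set g | act g xi = xi].

Lemma subgroup_stabilizer xi : xi 1%g = 0 -> subgroup (stabilizer xi).
Proof.
move=> xi1; split=> [|x y xx yy]; first exact: act1.
rewrite /stabilizer /= -actM.
have -> : act y^-1%g xi = xi by rewrite -[in LHS]yy actM mulVg act1.
exact: xx.
Qed.

Lemma stabilizerP xi h x : stabilizer xi h -> xi 1%g = 0 ->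
  xi (h * x)%g = xi h + xi x.
Proof.
move=> hh xi1; have hV : stabilizer xi h^-1%g.
  exact: subgroupV (subgroup_stabilizer xi1) hh.
by have := congr1 (@^~ x) hV; rewrite /act /= invgK => <-; rewrite addrC subrK.
Qed.

Lemma stabilizerX xi h n : stabilizer xi h -> xi 1%g = 0 ->
  xi (h ^+ n)%g = n%:R * xi h.
Proof.
move=> hh xi1; elim: n => [|n IH]; first by rewrite expg0 xi1 mul0r.
by rewrite expgS stabilizerP// IH -[n.+1]add1n natrD mulrDl mul1r.
Qed.

End Horofunctions.

(** * Finite sets *)

Lemma finite_range (T : eqType) (D : set T) : finite_set D ->
  exists n (s : 'I_n -> T), D = range s.
Proof.
move=> /finite_seqP[s ->]; exists (size s), (tnth (in_tuple s)).
apply/seteqP; split=> [x /= /(@tnthP _ _ (in_tuple s)) [i ->]|_ [i _ <-]].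
  by exists i.
exact: mem_tnth.
Qed.

Lemma finite_bounded (R : realType) (T : eqType) (D : set T) (h : T -> R) :
  finite_set D -> exists2 K, (0 <= K)%R & forall x, D x -> (h x <= K)%R.
Proof.
move=> /finite_seqP[s ->]; exists (\sum_(x <- s) `|h x|)%R; first exact: sumr_ge0.
move=> x /= xs; rewrite (big_rem x)//=.
by rewrite (le_trans (ler_norm _))// lerDl sumr_ge0.
Qed.

(** * Facets of a symmetric polytope *)

Section Facets.
Local Open Scope ring_scope.
Context {R : realType} {N : nat}.
Implicit Types (A D F : set 'rV[R]_N) (f g : {scalar 'rV[R]_N}) (x y : 'rV[R]_N).

Definition col_functional (a : 'cV[R]_N) : 'rV[R]_N -> R := fun x => (x *m a) 0 0.

Fact col_functional_linear a : linear_for *%R (col_functional a).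
Proof. by move=> k x y; rewrite /col_functional mulmxDl -scalemxAl !mxE. Qed.

HB.instance Definition _ a :=
  GRing.isLinear.Build R 'rV[R]_N R *%R (col_functional a) (col_functional_linear a).

(** Spanning in its dual form: the functionals to be compared are at hand, while
    linear combinations would have to be chosen. *)
Definition spanning D :=
  forall g, (forall x, D x -> g x = 0) -> forall x, g x = 0.

Lemma convex_setP A : convex_set A <->
  forall x y t, 0 <= t <= 1 -> A x -> A y -> A (t *: x + (1 - t) *: y).
Proof.
split=> [cA x y t /andP[t0 t1] Ax Ay|h x y t /set_mem Ax /set_mem Ay].
  exact: (set_mem (cA x y (Itv01 t0 t1) (mem_set Ax) (mem_set Ay))).
by apply: mem_set; apply: h => //; rewrite ge0 le1.
Qed.

Lemma sub_hull A : A `<=` Defs.conv A.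
Proof. by move=> x Ax B [_]; apply. Qed.

Lemma convex_hull A : convex_set (Defs.conv A).
Proof.
apply/convex_setP => x y t t01 Ax Ay B [cB AB].
by move/convex_setP : (cB); apply; [|exact: Ax|exact: Ay].
Qed.

Lemma hull_ind A B : convex_set B -> A `<=` B -> Defs.conv A `<=` B.
Proof. by move=> cB AB x; apply. Qed.

Lemma hull_le A f c : (forall x, A x -> f x <= c) ->
  forall x, Defs.conv A x -> f x <= c.
Proof.
move=> Ac; apply: hull_ind => //; apply/convex_setP => x y t /andP[t0 t1] fx fy.
rewrite /= linearD !linearZ /=.
have -> : c = t * c + (1 - t) * c by rewrite -mulrDl addrC subrK mul1r.
by apply: lerD; apply: ler_wpM2l => //; rewrite subr_ge0.
Qed.

(** Stated through a functional [g], this says that a point of the hull where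
    [f] is maximal lies in the span of the points of [A] where [f] is maximal. In
    this form it suffices that the points where [f <= c], and [g = 0] if [f = c],
    form a convex set. *)
Lemma hull_face_vanish A f g c : (forall x, A x -> f x <= c) ->
  (forall x, A x -> f x = c -> g x = 0) ->
  forall x, Defs.conv A x -> f x = c -> g x = 0.
Proof.
move=> Ac gA x Ax; suff: f x <= c /\ (f x = c -> g x = 0) by case.
move: x Ax; apply: hull_ind => [|x Ax]; last by split; [exact: Ac|exact: gA].
apply/convex_setP => x y t /andP[t0 t1] [fx gx] [fy gy].
have u0 : 0 <= 1 - t by rewrite subr_ge0.
rewrite /= !linearD !linearZ /=.
have cE : c = t * c + (1 - t) * c by rewrite -mulrDl addrC subrK mul1r.
have le1 := ler_wpM2l t0 fx; have le2 := ler_wpM2l u0 fy.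
split=> [|e]; first by rewrite [leRHS]cE lerD.
have e1 : t * f x = t * c.
  by move: le1 le2 e; set a := f x; set b := f y; lra.
have e2 : (1 - t) * f y = (1 - t) * c.
  by move: le1 le2 e; set a := f x; set b := f y; lra.
have -> : t * g x = 0.
  have [->|tn] := eqVneq t 0; first by rewrite mul0r.
  by rewrite gx ?mulr0//; exact: (mulfI tn).
rewrite add0r; have [->|un] := eqVneq (1 - t) 0; first by rewrite mul0r.
by rewrite gy ?mulr0//; exact: (mulfI un).
Qed.

Lemma hullN A : (forall x, A x -> A (- x)) ->
  forall x, Defs.conv A x -> Defs.conv A (- x).
Proof.
move=> As; apply: hull_ind => [|x /As]; last exact: sub_hull.
apply/convex_setP => x y t t01 Ax Ay; rewrite /= opprD -!scalerN.
by move: (@convex_hull A) => /convex_setP; apply.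
Qed.

Lemma hull0 A : (forall x, A x -> A (- x)) -> A !=set0 -> Defs.conv A 0.
Proof.
move=> As [x Ax]; have h : 0 <= (2^-1 : R) <= 1 by lra.
have := (convex_setP _).1 (@convex_hull A) x (- x) _ h
  (sub_hull Ax) (sub_hull (As _ Ax)).
have -> : 1 - 2^-1 = 2^-1 :> R by lra.
by rewrite scalerN subrr.
Qed.

(** ** Affine dimension *)

Lemma affine_dim_ge A k (x : 'I_k.+1 -> 'rV[R]_N) :
  (forall i, A (x i)) -> affinely_independent x -> (k <= affine_dim A)%N.
Proof.
move=> Ax indx; have kN : (k < N.+1)%N.
  move: indx; rewrite /affinely_independent /row_free ltnS => /eqP <-.
  exact: rank_leq_col.
by apply: (@bigop.leq_bigmax_cond _ _ _ (Ordinal kN)); apply/asboolP; exists x.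
Qed.

Lemma affine_dim_le A : (affine_dim A <= N)%N.
Proof. by apply/bigmax_leqP => -[k kN]. Qed.

Lemma affine_dim_attained A : A !=set0 ->
  exists x : 'I_(affine_dim A).+1 -> 'rV[R]_N,
    (forall i, A (x i)) /\ affinely_independent x.
Proof.
move=> [y Ay]; rewrite /affine_dim.
elim/big_ind : _ => [|m n hm hn|k /asboolP //].
  exists (fun=> y); split => //; rewrite /affinely_independent /row_free.
  by rewrite [\matrix_(_ < _) _]flatmx0 mxrank0.
by rewrite /maxn; case: ifP.
Qed.

Lemma row_free_affinely_independent k (x : 'I_k.+1 -> 'rV[R]_N) :
  row_free (\matrix_i x i) -> affinely_independent x.
Proof.
move=> /row_freeP[B xB]; apply: inj_row_free => v vx.
pose u : 'rV[R]_k.+1 := \row_i oapp (v 0) (- \sum_j v 0 j) (unlift ord0 i).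
suff u0 : u = 0.
  apply/rowP => j; have := congr1 (fun w : 'rV_k.+1 => w 0 (lift ord0 j)) u0.
  by rewrite !mxE liftK.
rewrite -[u]mulmx1 -xB mulmxA [u *m _](_ : _ = 0) ?mul0mx//.
rewrite mulmx_sum_row big_ord_recl mxE unlift_none /= rowK.
rewrite mulmx_sum_row in vx; rewrite -[RHS]vx scaleNr scaler_suml -sumrN -big_split /=.
by apply: eq_bigr => i _; rewrite mxE liftK /= !rowK scalerBr addrC.
Qed.

(** On a hyperplane that misses the origin, affine and linear independence
    agree. *)
Lemma affinely_independent_row_free f k (x : 'I_k.+1 -> 'rV[R]_N) :
  (forall i, f (x i) = 1) -> affinely_independent x -> row_free (\matrix_i x i).
Proof.
move=> fx /row_freeP[B xB]; apply: inj_row_free => u ux.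
have su : \sum_i u 0 i = 0.
  have := congr1 f ux; rewrite linear0 mulmx_sum_row linear_sum => e; rewrite -[RHS]e.
  by apply: eq_bigr => i _; rewrite linearZ /= rowK fx mulr1.
pose v : 'rV[R]_k := \row_i u 0 (lift ord0 i).
have v0 : v = 0.
  rewrite -[v]mulmx1 -xB mulmxA [v *m _](_ : _ = 0) ?mul0mx//.
  have : \sum_i u 0 i *: (x i - x ord0) = 0.
    under eq_bigr do rewrite scalerBr; rewrite sumrB -scaler_suml su scale0r subr0.
    rewrite -[RHS]ux mulmx_sum_row; by apply: eq_bigr => i _; rewrite rowK.
  rewrite big_ord_recl subrr scaler0 add0r => e; rewrite -[RHS]e.
  by rewrite mulmx_sum_row; apply: eq_bigr => i _; rewrite mxE rowK.
have uS j : u 0 (lift ord0 j) = 0.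
  by have := congr1 (fun w : 'rV_k => w 0 j) v0; rewrite !mxE.
apply/rowP => i; rewrite [in RHS]mxE; case: (unliftP ord0 i) => [j ->//|->].
by move: su; rewrite big_ord_recl big1 ?addr0.
Qed.

Lemma spanning_row_full n (s : 'I_n -> 'rV[R]_N) :
  spanning (range s) -> row_full (\matrix_i s i).
Proof.
move=> sp; rewrite /row_full -mxrank_tr -/(row_free _).
apply: inj_row_free => v vs.
have {}vs : \matrix_i s i *m v^T = 0.
  by apply: trmx_inj; rewrite trmx_mul trmxK vs trmx0.
suff h x : col_functional v^T x = 0.
  apply: trmx_inj; rewrite trmx0; apply/colP => i; have := h (delta_mx 0 i).
  by rewrite /col_functional -rowE !mxE.
move: x; apply: sp => _ [i _ <-].
have := congr1 (fun w : 'cV_n => w i 0) vs.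
rewrite [in RHS]mxE => e; rewrite -[RHS]e /= /col_functional !mxE.
by apply: eq_bigr => j _; rewrite !mxE.
Qed.

Lemma spanning_basis D k : k = N -> finite_set D -> spanning D ->
  exists x : 'I_k -> 'rV[R]_N, (forall i, D (x i)) /\ row_free (\matrix_i x i).
Proof.
move=> -> finD spD; have [n [s sD]] := finite_range finD.
have full : row_full (\matrix_i s i) by apply: spanning_row_full; rewrite -sD.
exists (fun i => s (fullrankfun full i)); split.
  by move=> i; rewrite sD; exists (fullrankfun full i).
have := fullrowsub_full full; rewrite /row_full /row_free.
by congr (\rank _ == _); apply/matrixP => i j; rewrite !mxE.
Qed.

(** ** Facets and supporting functionals *)

(** The normalised equation of a facet: as the hyperplane [f = 1] misses the
    origin, a face in it has dimension [N - 1] exactly when it spans. *)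
Definition facet_functional A f :=
  [/\ forall x, A x -> f x <= 1, A `&` [set x | f x = 1] !=set0 &
     spanning (A `&` [set x | f x = 1])].

Context (A : set 'rV[R]_N).
Hypotheses (finA : finite_set A) (oppA : forall x, A x -> A (- x))
  (spA : spanning A).

Lemma spanning_nonempty D : (0 < N)%N -> finite_set D -> spanning D -> D !=set0.
Proof.
move=> N0 finD spD; have [x [Dx _]] := spanning_basis erefl finD spD.
by exists (x (Ordinal N0)).
Qed.

Lemma affine_dim_hull : affine_dim (Defs.conv A) = N.
Proof.
apply/eqP; rewrite eqn_leq affine_dim_le /=.
have [N0|N0] := posnP N; first by rewrite [leqLHS]N0.
have [x [Ax freex]] := spanning_basis erefl finA spA.
pose y i := oapp x 0 (unlift ord0 i).
apply: (@affine_dim_ge _ _ y).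
  move=> i; rewrite /y; case: unliftP => [j _|_] /=; first exact: sub_hull.
  by apply: hull0 => //; exact: spanning_nonempty.
rewrite /affinely_independent /y; move: freex; congr (row_free _).
by apply/matrixP => i j; rewrite !mxE liftK unlift_none /= mxE subr0.
Qed.

Lemma facet_has_functional F : facet (Defs.conv A) F ->
  exists2 f, facet_functional A f & F = [set x | Defs.conv A x /\ f x = 1].
Proof.
move=> [[[f [c [Pc FE]]] [x0 Fx0] FP]].
rewrite affine_dim_hull => dimF.
have [Px0 fx0] : Defs.conv A x0 /\ f x0 = c by move: Fx0; rewrite FE.
have c0 : 0 < c.
  have := Pc _ (hullN oppA Px0); rewrite linearN fx0 => cc.
  rewrite lt_neqAle; apply/andP; split; last by lra.
  apply/eqP => c0; apply: FP; rewrite FE; apply/seteqP; split=> [x []//|x Px].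
  split => //; have := Pc _ (hullN oppA Px); have := Pc _ Px.
  by rewrite linearN -c0; lra.
pose f1 : {scalar 'rV[R]_N} := col_functional (\col_i (c^-1 * f (delta_mx 0 i))).
have f1E x : f1 x = c^-1 * f x.
  rewrite [in RHS](row_sum_delta x) linear_sum mulr_sumr /f1 /= /col_functional mxE.
  by apply: eq_bigr => i _; rewrite mxE linearZ /= mulrCA.
have f1c x : f1 x = 1 <-> f x = c.
  rewrite f1E; split=> [e|->]; last by rewrite mulVf// gt_eqF.
  by rewrite -[LHS](mulKf (lt0r_neq0 c0)) mulrCA e mulr1.
have f1le x : A x -> f1 x <= 1.
  move=> Ax; rewrite f1E mulrC ler_pdivrMr// mul1r; exact: Pc (sub_hull Ax).
have FE1 : F = [set x | Defs.conv A x /\ f1 x = 1].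
  by rewrite FE; apply/seteqP; split=> x [Px fx]; split => //; apply/f1c.
have [x [Fx indx]] := affine_dim_attained (ex_intro F x0 Fx0).
have sp1 : spanning (A `&` [set x | f1 x = 1]).
  move=> g gA z.
  have gF i : g (x i) = 0.
    have := Fx i; rewrite FE1 => -[Px fx].
    exact: (hull_face_vanish f1le (fun y Ay fy => gA y (conj Ay fy)) Px fx).
  have free : row_free (\matrix_i x i).
    apply: (affinely_independent_row_free (f := f1)) indx => i.
    by have := Fx i; rewrite FE1 => -[].
  have full : row_full (\matrix_i x i).
    by move: free; rewrite /row_free /row_full => /eqP ->; rewrite dimF.
  have /submxP[w ->] := submx_full z full.
  rewrite mulmx_sum_row linear_sum big1// => i _.
  by rewrite linearZ /= rowK gF mulr0.
exists f1 => //; split => //; apply: spanning_nonempty => //; first by rewrite -dimF.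
exact: finite_setIl.
Qed.

Lemma functional_facet f : facet_functional A f ->
  facet (Defs.conv A) [set x | Defs.conv A x /\ f x = 1].
Proof.
move=> [fle [a [Aa /= fa]] spf]; have N0 : (0 < N)%N.
  rewrite lt0n; apply/eqP => N0.
  have : f a = 0.
    have -> : a = 0.
      by apply/rowP => -[i iN]; exfalso; move: iN; rewrite [X in (_ < X)%N]N0.
    exact: linear0.
  by rewrite fa => /eqP; rewrite oner_eq0.
have ne : [set x | Defs.conv A x /\ f x = 1] !=set0.
  by exists a; split => //; exact: sub_hull.
split; first split => //.
- by exists f, 1; split => //; exact: hull_le.
- move=> e; have : Defs.conv A (- a) by apply: sub_hull; exact: oppA.
  by rewrite -e => -[_ /=]; rewrite linearN fa; lra.
rewrite affine_dim_hull; apply/eqP; rewrite eqn_leq; apply/andP; split.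
  have [x [Fx indx]] := affine_dim_attained ne.
  have := affinely_independent_row_free (fun i => (Fx i).2) indx.
  by rewrite /row_free => /eqP <-; exact: rank_leq_col.
have [x [Dx freex]] := spanning_basis (prednK N0) (finite_setIl _ finA) spf.
rewrite -[leqLHS](prednK N0) ltnS; apply: (@affine_dim_ge _ _ x).
  by move=> i; have [Ax fx] := Dx i; split => //; exact: sub_hull.
exact: row_free_affinely_independent.
Qed.

Lemma spanning_eq D f g : spanning D -> (forall x, D x -> f x = g x) ->
  forall x, f x = g x.
Proof.
move=> spD fg x; apply/eqP; rewrite -subr_eq0.
pose h : {scalar 'rV[R]_N} :=
  col_functional (\col_i (f (delta_mx 0 i) - g (delta_mx 0 i))).
have hE y : h y = f y - g y.
  rewrite [in RHS](row_sum_delta y) (linear_sum f) (linear_sum g) -sumrB.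
  rewrite /h /= /col_functional mxE.
  by apply: eq_bigr => i _; rewrite mxE mulrBr; congr (_ - _); rewrite linearZ.
rewrite -hE; apply/eqP; apply: spD => y Dy.
by rewrite hE fg// subrr.
Qed.

End Facets.

(** * The projection to the torsion-free abelianisation *)

Section RationalCombination.
Local Open Scope ring_scope.

(** Clearing denominators in a rational solution. *)
Lemma rational_combination n N (s : 'I_n -> 'rV[int]_N) :
  row_full (\matrix_i map_mx intr (s i) : 'M[rat]_(n, N)) ->
  forall v, exists2 m, (0 < m)%N & exists a : 'I_n -> int, v *+ m = \sum_i s i *~ a i.
Proof.
move=> full v; have /submxP[w wE] := submx_full (map_mx intr v : 'rV[rat]_N) full.
pose m := \prod_i denq (w 0 i).
have m0 : 0 < m by apply: prodr_gt0.
exists `|m|%N; first by rewrite absz_gt0 gt_eqF.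
exists (fun i => numq (w 0 i) * \prod_(j | j != i) denq (w 0 j)).
rewrite pmulrn gtz0_abs//; apply/rowP => j; rewrite summxE.
apply: (@intr_inj rat); rewrite rmorph_sum /=.
have := congr1 (fun u : 'rV_N => m%:~R * u 0 j) wE; rewrite !mxE => e.
have -> : (v *~ m) 0 j = m * v 0 j by rewrite -scaler_int mxE intz.
rewrite intrM e mulr_sumr; apply: eq_bigr => i _; rewrite !mxE.
rewrite -scaler_int mxE intz !rmorphM /= mulrA; congr (_ * _).
by rewrite numqE /m (bigD1 i)//= rmorphM /= mulrC mulrA.
Qed.

End RationalCombination.

Section Projection.
Local Open Scope ring_scope.
Context {R : realType} {G : groupType} {N : nat} (S : set G) (phi : G -> 'rV[int]_N).
Hypotheses (hG : nilpotent_group G) (finS : finite_set S)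
  (Ssym : symmetric_set S) (Sgen : generating_set S)
  (hphi : torsion_free_abelianisation phi).
Implicit Types (x y g h : G) (n : nat) (f : {scalar 'rV[R]_N}).

Local Notation pr := (@Defs.proj R G N phi).

Lemma phiM x y : phi (x * y)%g = phi x + phi y.
Proof. by case: hphi. Qed.

Lemma phi1 : phi 1%g = 0.
Proof. by apply: (addrI (phi 1%g)); rewrite -phiM mulg1 addr0. Qed.

Lemma phiV x : phi x^-1%g = - phi x.
Proof. by apply: (addrI (phi x)); rewrite -phiM mulgV phi1 subrr. Qed.

Lemma phiX x n : phi (x ^+ n)%g = phi x *+ n.
Proof. by elim: n => [|n IH]; rewrite ?expg0 ?phi1// expgS phiM IH mulrS. Qed.

Lemma phi_surj v : exists x, phi x = v.
Proof.
have [_ rphi _] := hphi; have : range phi v by rewrite rphi.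
by move=> [x _ <-]; exists x.
Qed.

Lemma projM x y : pr (x * y)%g = pr x + pr y.
Proof. by rewrite /Defs.proj phiM map_mxD. Qed.

Lemma projV x : pr x^-1%g = - pr x.
Proof. by rewrite /Defs.proj phiV map_mxN. Qed.

Lemma proj_id : pr 1%g = 0.
Proof. by rewrite /Defs.proj phi1 map_mx0. Qed.

Lemma fprojM f x y : f (pr (x * y)%g) = f (pr x) + f (pr y).
Proof. by rewrite projM linearD. Qed.

Lemma fprojV f x : f (pr x^-1%g) = - f (pr x).
Proof. by rewrite projV linearN. Qed.

Lemma fproj1 f : f (pr 1%g) = 0.
Proof. by rewrite proj_id linear0. Qed.

Lemma fprojX f x n : f (pr (x ^+ n)%g) = n%:R * f (pr x).
Proof.
elim: n => [|n IH]; first by rewrite expg0 fproj1 mul0r.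
by rewrite expgS fprojM IH -[n.+1]add1n natrD mulrDl mul1r.
Qed.

Lemma spanning_range_proj : spanning (range pr).
Proof.
move=> g g0 x; rewrite (row_sum_delta x) linear_sum big1// => i _.
rewrite linearZ /=; have [y yE] := phi_surj (delta_mx 0 i).
have -> : delta_mx 0 i = pr y by rewrite /Defs.proj yE map_delta_mx.
by rewrite g0 ?mulr0//; exists y.
Qed.

Lemma spanning_proj_gen : spanning (pr @` S).
Proof.
move=> g g0; apply: spanning_range_proj => _ [y _ <-].
elim: (products_generated Ssym Sgen y) => [|s z Ss _ IH]; first exact: fproj1.
by rewrite fprojM IH addr0; apply: g0; exists s.
Qed.

Lemma opp_proj_gen (v : 'rV[R]_N) : (pr @` S) v -> (pr @` S) (- v).
Proof. by move=> [s Ss <-]; exists s^-1%g; [exact: Ssym|exact: projV]. Qed.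

Lemma finite_proj_gen : finite_set (pr @` S).
Proof. exact: finite_image. Qed.

(** The homomorphism factors through the lattice, and is extended linearly from
    the basis of the lattice. *)
Lemma additive_functional (F : G -> R) :
  (forall x y, F (x * y)%g = F x + F y) -> (forall x, phi x = 0 -> F x = 0) ->
  exists f : {scalar 'rV[R]_N}, forall x, F x = f (pr x).
Proof.
move=> FM F0; have [e eE] := choice (fun v => phi_surj v).
have Fe x y : phi x = phi y -> F x = F y.
  move=> xy; rewrite -(mulgVK y x) FM F0 ?add0r//.
  by rewrite phiM phiV xy subrr.
have eadd u v : F (e (u - v)) = F (e u) - F (e v).
  apply/eqP; rewrite eq_sym subr_eq -FM; apply/eqP/Fe.
  by rewrite phiM !eE subrK.
pose Fm := GRing.isZmodMorphism.Build _ _ (F \o e) eadd.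
pose Fa : {additive 'rV[int]_N -> R} := HB.pack (F \o e) Fm.
exists (col_functional (\col_i F (e (delta_mx 0 i)))) => x.
rewrite (Fe x (e (phi x))) ?eE// -[LHS]/(Fa (phi x)) {1}(row_sum_delta (phi x)).
rewrite raddf_sum /= /col_functional mxE; apply: eq_bigr => i _.
rewrite !mxE -[phi x 0 i in LHS]intz scaler_int.
by rewrite -[LHS]/(Fa ('e_i *~ phi x 0 i)) raddfMz /= mulrzl.
Qed.

(** The integer matrix of the projections of [V] has the same rank over the
    rationals as over the reals, so every integer vector is a rational combination
    of its rows. *)
Lemma spanning_power (V L : set G) : finite_set V -> subgroup L -> V `<=` L ->
  spanning (pr @` V) ->
  forall g, exists2 m, (0 < m)%N & exists2 l, L l & phi (g ^+ m)%g = phi l.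
Proof.
move=> finV sL VL spV g.
have [n [s sV]] := finite_range finV.
have full : row_full (\matrix_i map_mx intr (phi (s i)) : 'M[rat]_(n, N)).
  have : row_full (\matrix_i pr (s i)).
    apply: spanning_row_full; suff -> : range (fun i => pr (s i)) = pr @` V by [].
    by rewrite sV image_comp.
  rewrite /row_full -(mxrank_map (@ratr R)) => /eqP e; apply/eqP.
  rewrite -[RHS]e; congr (\rank _).
  by apply/matrixP => i j; rewrite !mxE; exact: ratr_int.
have [m m0 [a aE]] := rational_combination full (phi g).
exists m => //; rewrite phiX aE.
have LZ k z : L k -> exists2 l, L l & phi k *~ z = phi l.
  move=> Lk; case: z => n'.
    by exists (k ^+ n')%g; [exact: subgroupX|rewrite phiX].
  exists (k ^- n'.+1)%g; last by rewrite phiV phiX.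
  by apply: subgroupV => //; exact: subgroupX.
elim/big_ind: _ => [|u v [k Lk ->] [l Ll ->]|i _].
- by exists 1%g; [exact: subgroup1|rewrite phi1].
- by exists (k * l)%g; [exact: subgroupM|rewrite phiM].
- have [|l Ll ->] := LZ (s i) (a i); last by exists l.
  by apply: VL; rewrite sV; exists i.
Qed.

(** A power of [g] agrees with an element of [L] up to torsion in the
    abelianisation, hence a further power agrees with one up to [gam 1]. *)
Lemma spanning_finite_index (V L : set G) : finite_set V -> subgroup L ->
  V `<=` L -> spanning (pr @` V) ->
  exists2 B, finite_set B & coset_representatives setT L B.
Proof.
move=> finV sL VL spV.
apply: (nilpotent_finite_index hG sL finS (products_generated Ssym Sgen)).
apply: nilpotent_power_in_subgroup => // g.
have [m m0 [l Ll gl]] := spanning_power finV sL VL spV g.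
have nK := normal_lcs (G := G) 1.
have [_ _ /(_ (l^-1 * g ^+ m)%g)] := hphi.
rewrite phiM phiV gl addNr => -[/(_ erefl) [n [n0 ln]] _].
rewrite -lcs1 in ln.
exists (m * n)%N; first by rewrite muln_gt0 m0.
exists (l ^+ n)%g; first exact: subgroupX.
have e : eqmod (gam 1) (l^-1 * g ^+ m * l)%g (l * (l^-1 * g ^+ m))%g.
  by apply: eqmod_sym => //; apply: eqmod_central; apply: lcs_commg; rewrite lcsE.
have := eqmod_expM nK n e; rewrite mulVKg -expgnA => h.
apply: (eqmod_trans nK _ (eqmod_sym nK h)).
by rewrite /eqmod mulKg.
Qed.

End Projection.

(** * The submonoid of a facet and its horofunction *)

Section FacetHorofunction.
Local Open Scope ring_scope.
Context {R : realType} {G : groupType} {N : nat} (S : set G) (phi : G -> 'rV[int]_N).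
Hypotheses (hG : nilpotent_group G) (finS : finite_set S)
  (Ssym : symmetric_set S) (Sgen : generating_set S)
  (hphi : torsion_free_abelianisation phi).
Context (f : {scalar 'rV[R]_N}).
Local Notation pr := (@Defs.proj R G N phi).
Local Notation len := (word_length S).
Local Notation dist := (word_dist S).
Hypothesis fle : forall s, S s -> f (pr s) <= 1.
Implicit Types (x y g h m : G) (xi : G -> R).

Lemma functional_le_length g : f (pr g) <= (len g)%:R.
Proof.
have [n ng] : exists n, len g = n by exists (len g).
elim: n g ng => [|n IH] g lg.
  have := word_length_word Ssym Sgen g; rewrite lg => /is_word_of0 ->.
  by rewrite (fproj1 hphi).
have [s [h [Ss lh gE]]] := word_length_gt0 Ssym Sgen lg.
rewrite lg gE (fprojM hphi) -natr1 addrC lerD ?fle//.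
by rewrite -lh; exact: IH.
Qed.

(** The elements that have a geodesic word whose letters all lie on the facet
    [f = 1]. *)
Definition cone : set G := [set g | f (pr g) = (len g)%:R].

Lemma cone1 : cone 1%g.
Proof. by rewrite /cone /= (fproj1 hphi) word_length1. Qed.

Lemma cone_length x y : cone x -> cone y -> len (x * y)%g = (len x + len y)%N.
Proof.
move=> cx cy; apply/eqP; rewrite eqn_leq word_lengthM//=.
rewrite -(ler_nat R) natrD -cx -cy -(fprojM hphi).
exact: functional_le_length.
Qed.

Lemma coneM x y : cone x -> cone y -> cone (x * y)%g.
Proof.
move=> cx cy; rewrite /cone /= cone_length// (fprojM hphi) natrD.
by rewrite (cx : _ = _) (cy : _ = _).
Qed.

Definition facet_generators : set G := [set s | S s /\ f (pr s) = 1].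
Local Notation V := facet_generators.

Lemma facet_generators_length s : V s -> len s = 1%N.
Proof.
move=> [Ss fs]; apply/eqP; rewrite eqn_leq word_length_gen//=.
by have := functional_le_length s; rewrite fs ler1n.
Qed.

Lemma facet_generators_cone s : V s -> cone s.
Proof. by move=> Vs; rewrite /cone /= facet_generators_length//; case: Vs. Qed.

Lemma cone_word g : cone g ->
  exists2 w : seq G, (forall a, a \in w -> V a) & g = (\prod_(a <- w) a)%g.
Proof.
have [n ng] : exists n, len g = n by exists (len g).
elim: n g ng => [|n IH] g lg cg.
  exists [::] => //; rewrite big_nil.
  by have := word_length_word Ssym Sgen g; rewrite lg => /is_word_of0 ->.
have [s [h [Ss lh gE]]] := word_length_gt0 Ssym Sgen lg.
have := functional_le_length h; have := fle Ss.
have : f (pr s) + f (pr h) = n%:R + 1.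
  by rewrite -(fprojM hphi) -gE (cg : _ = _) lg -natr1.
rewrite lh => e s1 h1.
have [|w Vw hE] := IH h lh; first by rewrite /cone /= lh; lra.
exists (s :: w); last by rewrite big_cons gE hE.
by move=> a; rewrite inE => /orP[/eqP ->|/Vw //]; split => //; lra.
Qed.

Lemma cone_common_multiple a b : cone a -> cone b ->
  exists c d, [/\ cone c, cone d & (a * c = b * d)%g].
Proof. exact: nilpotent_common_multiple hG coneM cone1. Qed.

(** [dist x m - len m] does not increase when [m] is multiplied on the right in
    the submonoid, where any two elements have a common right multiple; so
    this minimum is also a limit. *)
Definition cone_horofunction xi := forall x,
  (exists2 m, cone m & xi x = (dist x m)%:R - (len m)%:R) /\
  forall m, cone m -> xi x <= (dist x m)%:R - (len m)%:R.

Lemma cone_horofunction_exists : exists xi, cone_horofunction xi.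
Proof.
pose P x (r : R) := (exists2 m, cone m & r = (dist x m)%:R - (len m)%:R) /\
  forall m, cone m -> r <= (dist x m)%:R - (len m)%:R.
suff /choice[xi hxi] : forall x, exists r, P x r by exists xi.
move=> x; rewrite {}/P.
have tri m : (len m <= dist x m + len x)%N.
  rewrite -(word_dist1 S m) -(word_dist1 S x) addnC.
  exact: word_dist_triangle.
pose P k := `[< exists2 m, cone m & k = (dist x m + len x - len m)%N >].
have exP : exists k, P k by eexists; apply/asboolP; exists 1%g; [exact: cone1|].
have [k /asboolP[m cm kE] mink] := ex_minnP exP.
exists ((dist x m)%:R - (len m)%:R); split; first by exists m.
move=> m' cm'; have : (k <= dist x m' + len x - len m')%N.
  by apply: mink; apply/asboolP; exists m'.
rewrite kE -(ler_nat R) !natrB ?tri// !natrD; lra.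
Qed.

Lemma cone_horofunction_unique xi xi' :
  cone_horofunction xi -> cone_horofunction xi' -> xi = xi'.
Proof.
move=> h h'; apply/funext => x; apply/le_anti; apply/andP; split.
  by have [[m cm ->] _] := h' x; exact: (h x).2.
by have [[m cm ->] _] := h x; exact: (h' x).2.
Qed.

(** All such paths have the same limit, in whatever order they use the
    generators of the facet. *)
Definition dominating (gamma : nat -> G) := forall m, cone m ->
  exists T, forall t, (T <= t)%N -> cone (m^-1 * gamma t)%g.

Lemma dominating_converges gamma xi : dominating gamma ->
  cone_horofunction xi -> converges_to S gamma xi.
Proof.
move=> dom hxi; apply/converges_toP => x.
have [[m cm xiE] xile] := hxi x.
have [T hT] := dom m cm; have [T' hT'] := dom 1%g cone1.
exists (maxn T T') => t; rewrite geq_max => /andP[/hT c /hT'].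
rewrite invg1 mul1g => cg; rewrite psiE word_dist1; apply/eqP.
rewrite eq_le xile// andbT xiE.
have := cone_length cm c; rewrite mulVKg => ->.
have : (dist x (gamma t))%:R <= (dist x m)%:R + (len (m^-1 * gamma t)%g)%:R :> R.
  by rewrite -natrD ler_nat; exact: word_dist_triangle.
by rewrite natrD; lra.
Qed.

Section Properties.
Context (xi : G -> R) (hxi : cone_horofunction xi).

Lemma cone_horofunction_id : xi 1%g = 0.
Proof.
have [[m _ ->] _] := hxi 1%g.
by rewrite word_dist1 subrr.
Qed.

(** Common multiples let one replace the infimum over the submonoid by the
    infimum over the multiples of [v]. *)
Lemma cone_horofunction_mull v x : cone v -> xi (v * x)%g = xi x - (len v)%:R.
Proof.
move=> cv; apply/le_anti; apply/andP; split.
  have [[m cm ->] _] := hxi x.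
  apply: le_trans ((hxi (v * x)%g).2 _ (coneM cv cm)) _.
  by rewrite word_dist_mull cone_length// natrD; lra.
have [[m cm ->] _] := hxi (v * x)%g.
have [a [b [ca cb ab]]] := cone_common_multiple cm cv.
have := (hxi x).2 _ cb; rewrite -(word_dist_mull S v) -ab.
have := cone_length cv cb; rewrite -ab cone_length// => e.
have : (dist (v * x) (m * a))%:R <= (dist (v * x) m)%:R + (len a)%:R :> R.
  rewrite -natrD ler_nat (leq_trans (word_dist_triangle Ssym Sgen m _ _))//.
  by rewrite /word_dist mulKg.
have : (len m)%:R + (len a)%:R = (len v)%:R + (len b)%:R :> R by rewrite -!natrD e.
by lra.
Qed.

Lemma cone_stabilizer v : cone v -> stabilizer xi v.
Proof.
move=> cv; have sxi := subgroup_stabilizer cone_horofunction_id.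
rewrite -(invgK v); apply: (subgroupV sxi); apply/funext => x; rewrite /act invgK.
rewrite cone_horofunction_mull// -[in xi v](mulg1 v) cone_horofunction_mull//.
by rewrite cone_horofunction_id; lra.
Qed.

(** For [m] in the submonoid, [f] is the length of [m] and at most the length of
    [x^-1 * m], which is [dist x m]. *)
Lemma cone_horofunction_ge x : - f (pr x) <= xi x.
Proof.
have [[m cm ->] _] := hxi x.
have := functional_le_length (x^-1 * m)%g.
by rewrite (fprojM hphi) (fprojV hphi) (cm : _ = _) /word_dist; lra.
Qed.

Lemma cone_horofunction_lipschitz x y : xi x <= xi y + (dist x y)%:R.
Proof.
have [[m cm ->] _] := hxi y; apply: le_trans ((hxi x).2 _ cm) _.
have : (dist x m)%:R <= (dist x y)%:R + (dist y m)%:R :> R.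
  by rewrite -natrD ler_nat; exact: word_dist_triangle.
by lra.
Qed.

Hypothesis spV : spanning (pr @` V).

Let finite_index :
  exists2 B, finite_set B & coset_representatives setT (stabilizer xi) B.
Proof.
apply: (spanning_finite_index hG finS Ssym Sgen hphi (V := V)) => //.
- by apply: (sub_finite_set _ finS) => s [].
- exact: subgroup_stabilizer cone_horofunction_id.
- by move=> s /facet_generators_cone /cone_stabilizer.
- exact: spV.
Qed.

Lemma cone_horofunction_finite_orbit : finite_set (orbit xi).
Proof.
have [B finB rB] := finite_index.
apply: (sub_finite_set (B := (fun b => act b^-1%g xi) @` B)); last exact: finite_image.
move=> _ [g _ <-]; have [b Bb sb] := rB g^-1%g I; exists b => //.
have : stabilizer xi (b * g)%g.
  rewrite -(invgK (b * g)%g) invgM.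
  exact: subgroupV (subgroup_stabilizer cone_horofunction_id) sb.
by rewrite /stabilizer /= => e; rewrite -[in LHS]e actM mulKg.
Qed.

(** On the stabilizer, [xi] is a homomorphism bounded below by the homomorphism
    [- f], hence equal to it; and the stabilizer has finite index. *)
Lemma cone_horofunction_bounded : exists C, forall x, `|xi x + f (pr x)| <= C.
Proof.
have [B finB rB] := finite_index; have xi1 := cone_horofunction_id.
have [K K0 hK] := finite_bounded (fun b => (len b)%:R : R) finB.
exists (2 * K) => x; have [b Bb sb] := rB x I.
have hE h : stabilizer xi h -> xi h = - f (pr h).
  move=> sh; have := cone_horofunction_ge h; have := cone_horofunction_ge h^-1%g.
  have := stabilizerP h^-1%g sh xi1; rewrite mulgV xi1 (fprojV hphi); lra.
have fb : `|f (pr b)| <= K.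
  rewrite ler_norml; have := hK b Bb; have := functional_le_length b.
  have := functional_le_length b^-1%g; rewrite word_lengthV// (fprojV hphi).
  by move=> h1 h2 h3; apply/andP; split; lra.
have xb : `|xi b| <= K.
  have := cone_horofunction_lipschitz b 1%g; have := cone_horofunction_lipschitz 1%g b.
  rewrite [dist b _]word_distC// word_dist1 xi1 ler_norml; have := hK b Bb.
  by move=> h1 h2 h3; apply/andP; split; lra.
rewrite -(mulgVK b x) stabilizerP// (fprojM hphi) hE//.
set c := f (pr (x * b^-1)%g).
have -> : - c + xi b + (c + f (pr b)) = xi b + f (pr b) by ring.
by apply: le_trans (ler_normD _ _) _; rewrite mulr2n mulrDl mul1r lerD.
Qed.

End Properties.

(** ** A geodesic that dominates the submonoid *)

Hypothesis V0 : V !=set0.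

(** Balls being finite, finitely many common multiples produce the word; one
    more letter makes it nonempty. *)
Lemma cone_upper_bound g n : cone g -> exists2 w : seq G,
  (forall a, a \in w -> V a) /\ (0 < size w)%N &
  forall m, cone m -> (len m <= n)%N -> cone (m^-1 * (g * \prod_(a <- w) a))%g.
Proof.
move=> cg; have [v0 Vv0] := V0; have cv0 := facet_generators_cone Vv0.
suff [u cu hu] : exists2 u, cone u &
    forall m, cone m -> (len m <= n)%N -> cone (m^-1 * (g * u))%g.
  have [w Vw uE] := cone_word cu.
  exists (rcons w v0); first split.
  - by move=> a; rewrite mem_rcons inE => /orP[/eqP ->|/Vw].
  - by rewrite size_rcons.
  move=> m cm mn; rewrite -cats1 big_cat big_seq1 -uE /= !mulgA.
  by apply: coneM => //; rewrite -mulgA; exact: hu.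
have [s sE] := (finite_seqP _).1 (word_ball_finite Ssym Sgen n finS).
suff h (r : seq G) : exists2 u, cone u &
    forall m, m \in r -> cone m -> cone (m^-1 * (g * u))%g.
  have [u cu hu] := h s; exists u => // m cm mn; apply: hu => //.
  by have : [set h | (len h <= n)%N] m by []; rewrite sE.
elim: r => [|a r [u cu hu]]; first by exists 1%g => //; exact: cone1.
have [ca|nca] := pselect (cone a); last first.
  by exists u => // m; rewrite inE => /orP[/eqP ->|/hu].
have [c [d [cc cd e]]] := cone_common_multiple (coneM cg cu) ca.
exists (u * c)%g; first exact: coneM.
move=> m; rewrite inE => /orP[/eqP -> _|mr cm].
  by rewrite [(g * (u * c))%g]mulgA e mulKg.
by rewrite !mulgA; apply: coneM => //; rewrite -mulgA; exact: hu.
Qed.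

Lemma dominating_geodesic : exists gamma,
  [/\ geodesic_path S gamma, dominating gamma,
      forall t, V ((gamma t)^-1 * gamma t.+1)%g &
      forall t, cone (gamma t) /\ len (gamma t) = t].
Proof.
pose P g (w : seq G) := cone g -> ((forall a, a \in w -> V a) /\ (0 < size w)%N) /\
  forall m, cone m -> (len m <= len g)%N -> cone (m^-1 * (g * \prod_(a <- w) a))%g.
have /choice[W hW] : forall g, exists w, P g w.
  move=> g; have [cg|ncg] := pselect (cone g); last by exists [::].
  by have [w] := cone_upper_bound (len g) cg; exists w.
(* A state is a position with the letters still to be spelled out; when they
   run out, a word leading beyond a large ball is chosen. *)
pose word (st : G * seq G) := if st.2 is [::] then W st.1 else st.2.
pose next st : G * seq G := ((st.1 * head 1 (word st))%g, behead (word st)).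
pose state t := iter t next (1%g, [::]).
pose ok (st : G * seq G) := cone st.1 /\ forall a, a \in st.2 -> V a.
have word_ok st : ok st -> (forall a, a \in word st -> V a) /\ (0 < size (word st))%N.
  by move=> [c1 V2]; rewrite /word; case: st.2 V2 => [|a r] //; have [] := hW _ c1.
have step_ok st : ok st -> V (head 1%g (word st)) /\ ok (next st).
  move=> okst; have [] := word_ok st okst; rewrite /next.
  case: (word st) => [//|a r] /= Vw _.
  have Va : V a by apply: Vw; rewrite mem_head.
  split => //; split; last by move=> b br; apply: Vw; rewrite inE br orbT.
  by apply: coneM; [exact: okst.1|exact: facet_generators_cone].
have state_ok t : ok (state t).
  elim: t => [|t IH]; first by split; [exact: cone1|].
  by rewrite /state iterS; exact: (step_ok _ IH).2.
pose gamma t := (state t).1.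
have stepV t : V ((gamma t)^-1 * gamma t.+1)%g.
  rewrite /gamma /state iterS /= mulKg; exact: (step_ok _ (state_ok t)).1.
have cone_diff s t : (s <= t)%N ->
    cone ((gamma s)^-1 * gamma t)%g /\ len ((gamma s)^-1 * gamma t)%g = (t - s)%N.
  move=> /subnK <-; elim: (t - s)%N => [|k [ck lk]].
    by rewrite add0n mulVg subnn word_length1//; split => //; exact: cone1.
  have cv := facet_generators_cone (stepV (k + s)%N).
  have -> : ((gamma s)^-1 * gamma (k.+1 + s)%N =
    (gamma s)^-1 * gamma (k + s)%N * ((gamma (k + s)%N)^-1 * gamma (k + s)%N.+1))%g.
    by rewrite addSn -[RHS]mulgA mulVKg.
  split; first exact: coneM.
  by rewrite cone_length// lk (facet_generators_length (stepV _)) !addnK addn1.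
have spell w g : iter (size w) next (g, w) = ((g * \prod_(a <- w) a)%g, [::]).
  elim: w g => [|a w IH] g; first by rewrite big_nil mulg1.
  by rewrite /= -iterS iterSr /next /= IH big_cons mulgA.
exists gamma; split=> //.
- move=> s t; have [st|ts] := leqP s t.
    by rewrite /word_dist (cone_diff _ _ st).2 distnEr.
  by rewrite word_distC// /word_dist (cone_diff _ _ (ltnW ts)).2 distnEl// ltnW.
- move=> m cm.
  pose t1 := (len m + size (state (len m)).2)%N.
  have nil1 : state t1 = (gamma t1, [::]).
    have e : state t1 = iter (size (state (len m)).2) next (state (len m)).
      by rewrite /state /t1 addnC iterD.
    have {}e : (state t1).2 = [::].
      rewrite e [X in iter _ _ X]surjective_pairing; move: (state _) => [g w] /=.
      by rewrite spell.
    by rewrite [LHS]surjective_pairing e.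
  have ct1 := state_ok t1; rewrite nil1 in ct1.
  have lt1 : len (gamma t1) = t1.
    have := (cone_diff 0%N t1 (leq0n _)).2.
    by rewrite /(gamma 0%N) /= invg1 mul1g subn0.
  have [[_ sW] domW] := hW _ ct1.1.
  exists (t1 + size (W (gamma t1)))%N => t tt.
  have e : gamma (t1 + size (W (gamma t1)))%N =
      (gamma t1 * \prod_(a <- W (gamma t1)) a)%g.
    rewrite /gamma /state addnC iterD -/(state t1) nil1 /=.
    have nextW : next (gamma t1, [::]) = next (gamma t1, W (gamma t1)).
      by rewrite /next /word /=; case: (W (gamma t1)).
    by rewrite -(prednK sW) iterSr nextW -iterSr prednK// spell.
  have c1 : cone (m^-1 * gamma (t1 + size (W (gamma t1))))%g.
    by rewrite e; apply: domW => //; rewrite lt1 leq_addr.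
  have := coneM c1 (cone_diff _ _ tt).1.
  by rewrite -mulgA mulVKg.
move=> t; split; first exact: (state_ok t).1.
have := (cone_diff 0%N t (leq0n _)).2.
by rewrite /(gamma 0%N) /= invg1 mul1g subn0.
Qed.

End FacetHorofunction.

(** * Limits of geodesics with a finite orbit *)

Section Limits.
Local Open Scope ring_scope.
Context {R : realType} {G : groupType} (S : set G).
Hypotheses (Ssym : symmetric_set S) (Sgen : generating_set S).
Local Notation len := (word_length S).
Local Notation dist := (word_dist S).
Implicit Types (gamma : nat -> G) (xi : G -> R) (x y g : G).

Lemma natmul_bounded (a b : R) : (forall n : nat, n%:R * a <= b) -> a <= 0.
Proof.
move=> h; rewrite leNgt; apply/negP => a0.
have b0 : 0 <= b by have := h 0%N; rewrite mul0r.
have := h (Num.bound (b / a)); apply/negP; rewrite -ltNge -ltr_pdivrMr//.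
by apply: archi_boundP; rewrite divr_ge0// ltW.
Qed.

Section Limit.
Context (gamma : nat -> G) (xi : G -> R) (lim : converges_to S gamma xi).

Lemma limit_id : xi 1%g = 0.
Proof.
have [T hT] := (converges_toP _ _ _).1 lim 1%g.
by rewrite -(hT T)// psiE subrr.
Qed.

Lemma limit_lipschitz x y : xi x <= xi y + (dist x y)%:R.
Proof.
have [T hT] := (converges_toP _ _ _).1 lim x.
have [T' hT'] := (converges_toP _ _ _).1 lim y.
rewrite -(hT (maxn T T')) ?leq_maxl// -(hT' (maxn T T')) ?leq_maxr// !psiE.
set z := gamma _.
have : (dist x z)%:R <= (dist x y)%:R + (dist y z)%:R :> R.
  by rewrite -natrD ler_nat; exact: word_dist_triangle.
by lra.
Qed.

Lemma limit_ge x : - (len x)%:R <= xi x.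
Proof.
by have := limit_lipschitz 1%g x; rewrite limit_id word_dist1; lra.
Qed.

Hypotheses (geo : geodesic_path S gamma) (g0 : gamma 0%N = 1%g).

Lemma geodesic_length t : len (gamma t) = t.
Proof. by rewrite -(word_dist1 S) -g0 geodesic_dist// subn0. Qed.

Lemma limit_path t : xi (gamma t) = - t%:R.
Proof.
have [T hT] := (converges_toP _ _ _).1 lim (gamma t).
rewrite -(hT (maxn T t)) ?leq_maxl// psiE word_dist1 geodesic_length.
by rewrite geodesic_dist ?leq_maxr// natrB ?leq_maxr//; lra.
Qed.

End Limit.

Lemma limit_shift gamma xi t0 : converges_to S gamma xi ->
  converges_to S (fun t => (gamma t0)^-1 * gamma (t0 + t)%N)%g
    (act (gamma t0)^-1%g xi).
Proof.
move=> /converges_toP cvg; apply/converges_toP => x.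
have [T hT] := cvg (gamma t0 * x)%g; have [T' hT'] := cvg (gamma t0).
exists (maxn T T') => t; rewrite geq_max => /andP[Tt T't].
rewrite /act invgK -(hT (t0 + t)%N) ?(leq_trans Tt) ?leq_addl//.
rewrite -(hT' (t0 + t)%N) ?(leq_trans T't) ?leq_addl// !psiE.
rewrite -(word_dist_mull S (gamma t0) x) -(word_dist_mull S (gamma t0) 1%g).
by rewrite mulVKg mulg1; lra.
Qed.

Lemma geodesic_shift gamma t0 : geodesic_path S gamma ->
  geodesic_path S (fun t => (gamma t0)^-1 * gamma (t0 + t)%N)%g.
Proof.
move=> geo s t; rewrite word_dist_mull geo.
by congr (`|_|%N); rewrite !PoszD; ring.
Qed.

Section FiniteOrbit.
Context (xi : G -> R) (xi1 : xi 1%g = 0) (fin : finite_set (orbit xi)).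

Lemma finite_orbit_index :
  exists2 B, finite_set B & coset_representatives setT (stabilizer xi) B.
Proof.
pose P eta g := orbit xi eta -> act g xi = eta.
have /choice[c hc] : forall eta, exists g, P eta g.
  move=> eta; have [[g _ <-]|no] := pselect (orbit xi eta); first by exists g.
  by exists 1%g.
exists ((fun eta => (c eta)^-1%g) @` orbit xi); first exact: finite_image.
move=> x _; have ox : orbit xi (act x^-1%g xi) by exists x^-1%g.
exists (c (act x^-1%g xi))^-1%g; first by exists (act x^-1%g xi).
by rewrite invgK /stabilizer /= -actM hc// actM mulgV act1.
Qed.

(** By the pigeonhole principle, two of the cosets of [1, g, .., g ^+ n]
    coincide if there are at most [n] of them; so [g ^+ m] stabilizes [xi] for
    some positive [m <= n], and [m] divides [n`!]. *)
Lemma finite_orbit_power :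
  exists2 k, (0 < k)%N & forall g, stabilizer xi (g ^+ k)%g.
Proof.
have [B /finite_seqP[s ->] rB] := finite_orbit_index.
have sxi := subgroup_stabilizer xi1.
exists (size s)`!; first exact: fact_gt0.
move=> g; pose P i b := b \in s /\ stabilizer xi (g ^+ i * b^-1)%g.
have /choice[c hc] : forall i : nat, exists b, P i b.
  by move=> i; have [b] := rB (g ^+ i)%g I; exists b.
have : ~~ uniq (map c (iota 0 (size s).+1)).
  apply/negP => uc; have : {subset map c (iota 0 (size s).+1) <= s}.
    by move=> _ /mapP[i _ ->]; exact: (hc i).1.
  by move=> /(uniq_leq_size uc); rewrite size_map size_iota ltnn.
move=> /(uniqPn 1%g)[i [j [ij]]]; rewrite size_map size_iota => js.
have is_ := ltn_trans ij js.
rewrite !(nth_map 0%N) ?size_iota// !nth_iota// !add0n => e.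
have := subgroupM sxi (hc j).2 (subgroupV sxi (hc i).2).
rewrite e invgM invgK mulgA mulgVK -expgnFr; last exact: ltnW.
move=> h; have /dvdnP[q ->] : (j - i %| (size s)`!)%N.
  apply: dvdn_fact; rewrite subn_gt0 ij /=.
  exact: leq_trans (leq_subr _ _) (ltnSE js).
by rewrite mulnC expgnA; exact: subgroupX.
Qed.

End FiniteOrbit.

End Limits.

Section FiniteOrbitLimit.
Local Open Scope ring_scope.
Context {R : realType} {G : groupType} {N : nat} (S : set G) (phi : G -> 'rV[int]_N).
Hypotheses (hG : nilpotent_group G) (finS : finite_set S)
  (Ssym : symmetric_set S) (Sgen : generating_set S)
  (hphi : torsion_free_abelianisation phi).
Local Notation pr := (@Defs.proj R G N phi).
Local Notation len := (word_length S).
Local Notation dist := (word_dist S).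
Implicit Types (f : {scalar 'rV[R]_N}) (gamma : nat -> G) (xi : G -> R) (x y g : G).

(** On its stabilizer, [xi] is a homomorphism to a torsion-free abelian group.
    The stabilizer contains a power of every element, so this homomorphism
    vanishes where [phi] does, and extends to a functional. *)
Lemma finite_orbit_functional gamma xi : converges_to S gamma xi ->
  finite_set (orbit xi) ->
  exists f, (exists C, forall x, `|xi x + f (pr x)| <= C) /\
            forall s, S s -> f (pr s) <= 1.
Proof.
move=> lim fin; have xi1 := limit_id lim.
have sxi := subgroup_stabilizer xi1.
have [B finB rB] := finite_orbit_index xi1 fin.
have [k k0 Hk] := finite_orbit_power xi1 fin.
have kR : k%:R != 0 :> R by rewrite pnatr_eq0 -lt0n.
pose L : set G := [set h | stabilizer xi h /\ xi h = 0].
have xiV h : stabilizer xi h -> xi h^-1%g = - xi h.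
  by move=> sh; have := stabilizerP h^-1%g sh xi1; rewrite mulgV xi1; lra.
have sL : subgroup L.
  split; first by split=> //; exact: subgroup1.
  move=> x y [sx x0] [sy y0]; split; first by case: sxi => _; apply.
  by rewrite stabilizerP// x0 add0r xiV// y0 oppr0.
have LH x y : stabilizer xi x -> stabilizer xi y -> L [~ x, y]%g.
  move=> sx sy; split; first exact: subgroup_commg.
  have sxV := subgroupV sxi sx; have syV := subgroupV sxi sy.
  rewrite commgEl conjgE !stabilizerP// !xiV//; lra.
have pow g : exists2 m, (0 < m)%N & stabilizer xi (g ^+ m)%g by exists k.
have kill h : stabilizer xi h -> phi h = 0 -> xi h = 0.
  have [_ _ ker] := hphi => sh /ker[n [n0]]; rewrite -lcs1 => hn.
  have [m m0 [_]] := nilpotent_power_commutator hG sL pow LH hn.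
  rewrite -expgnA stabilizerX// => /eqP; rewrite mulf_eq0 pnatr_eq0 muln_eq0.
  by rewrite !gtn_eqF//= => /eqP.
have xiM x y : xi ((x * y) ^+ k)%g = xi (x ^+ k)%g + xi (y ^+ k)%g.
  rewrite -(stabilizerP (y ^+ k)%g (Hk x) xi1).
  rewrite -[X in xi X = _](mulgVK (x ^+ k * y ^+ k)%g).
  have sc : stabilizer xi ((x * y) ^+ k * (x ^+ k * y ^+ k)^-1)%g.
    apply: (subgroupM sxi) => //; apply: (subgroupV sxi); exact: subgroupM.
  rewrite stabilizerP// kill ?add0r// (phiM hphi) (phiV hphi) (phiM hphi).
  by rewrite !(phiX hphi) (phiM hphi) mulrnDl subrr.
have [f fE] : exists f, forall x, - (xi (x ^+ k)%g / k%:R) = f (pr x).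
  apply: (additive_functional hphi) => [x y|x x0]; first by rewrite xiM mulrDl opprD.
  by rewrite kill ?mul0r ?oppr0// (phiX hphi) x0 mul0rn.
have fH h : stabilizer xi h -> f (pr h) = - xi h.
  by move=> sh; rewrite -fE stabilizerX// mulrAC mulfV// mul1r.
exists f; split.
  have [K K0 hK] := finite_bounded (fun b => `|xi b + f (pr b)|) finB.
  exists K => x; have [b Bb sb] := rB x I.
  rewrite -(mulgVK b x) stabilizerP// (fprojM hphi) fH// addrACA subrr add0r.
  exact: hK.
move=> s Ss; rewrite -fE -mulNr ler_pdivrMr ?ltr0n// mul1r.
have := limit_ge Ssym Sgen lim (s ^+ k)%g.
have : (len (s ^+ k)%g)%:R <= k%:R :> R.
  rewrite ler_nat (leq_trans (word_lengthX Ssym Sgen _ _))//.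
  by rewrite -[leqRHS]muln1 leq_mul2l word_length_gen// orbT.
by lra.
Qed.

Section Path.
Context (gamma : nat -> G) (xi : G -> R) (f : {scalar 'rV[R]_N}) (C : R).
Hypotheses (lim : converges_to S gamma xi) (geo : geodesic_path S gamma)
  (g0 : gamma 0%N = 1%g) (bounded : forall x, `|xi x + f (pr x)| <= C)
  (fle : forall s, S s -> f (pr s) <= 1).

Local Notation step t := ((gamma t)^-1 * gamma t.+1)%g.

Lemma fproj_step t : f (pr (gamma t.+1)) = f (pr (gamma t)) + f (pr (step t)).
Proof. by rewrite -(fprojM hphi) mulVKg. Qed.

(** The nondecreasing sequence [t - f (gamma t)] is bounded, and its positive
    increments are bounded below since there are finitely many generators. *)
Lemma eventually_facet_steps :
  exists t0, forall t, (t0 <= t)%N -> f (pr (step t)) = 1.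
Proof.
have [K K0 hK] := finite_bounded (fun s => (1 - f (pr s))^-1) finS.
pose D t : R := t%:R - f (pr (gamma t)).
have DC t : D t <= C.
  have := bounded (gamma t); rewrite (limit_path lim geo g0) ler_norml => /andP[+ _].
  by rewrite /D; lra.
have DS t : D t.+1 = D t + (1 - f (pr (step t))).
  by rewrite /D fproj_step -natr1; lra.
have Dmon s t : (s <= t)%N -> D s <= D t.
  move=> /subnK <-; elim: (t - s)%N => [//|k IH].
  rewrite addSn DS (le_trans IH)// lerDl subr_ge0.
  exact/fle/(geodesic_step Ssym Sgen).
apply: contrapT => no.
have big n : exists t, n%:R <= K * D t.
  elim: n => [|n [t nt]].
    by exists 0%N; rewrite /D g0 (fproj1 hphi) subr0 mulr0.
  have [t' tt' bad] : exists2 t', (t <= t')%N & f (pr (step t')) != 1.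
    apply: contrapT => h; apply: no; exists t => t' tt'.
    by apply/eqP/negPn/negP => bad; apply: h; exists t'.
  have St' := geodesic_step Ssym Sgen t' geo.
  have pos : 0 < 1 - f (pr (step t')) by rewrite subr_gt0 lt_neqAle bad fle.
  exists t'.+1; rewrite DS mulrDr -natr1 lerD//.
    by rewrite (le_trans nt)// ler_wpM2l// Dmon.
  by rewrite -ler_pdivrMr// mul1r hK.
have [t ht] := big (Num.bound (K * C)).
have C0 : 0 <= C by apply: le_trans (bounded 1%g).
have := archi_boundP (mulr_ge0 K0 C0).
have := ler_wpM2l K0 (DC t).
by lra.
Qed.

Hypothesis steps : forall t, f (pr (step t)) = 1.

Lemma facet_path t : f (pr (gamma t)) = t%:R.
Proof.
elim: t => [|t IH]; first by rewrite g0 (fproj1 hphi).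
by rewrite fproj_step IH steps natr1.
Qed.

(** Suppose that [g] vanishes on the generators of the facet. Along a word, [g]
    grows by at most [K] times the defect [len - f]. The defect of
    [x ^- n * gamma t] stays bounded, while [g] takes the value [- n * g x] there,
    so [g x] is 0. *)
Lemma facet_steps_spanning : spanning (pr @` facet_generators S phi f).
Proof.
move=> g gV; apply: (spanning_range_proj hphi) => _ [x _ <-].
have [K K0 hK] := finite_bounded (fun s => `|g (pr s)| / (1 - f (pr s))) finS.
have gS s : S s -> `|g (pr s)| <= K * (1 - f (pr s)).
  move=> Ss; have [fs|fs] := eqVneq (f (pr s)) 1.
    by rewrite gV ?normr0 ?mulr_ge0 ?subr_ge0 ?fs//; exists s.
  by rewrite -ler_pdivrMr ?hK// subr_gt0 lt_neqAle fs fle.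
have gK u : `|g (pr u)| <= K * ((len u)%:R - f (pr u)).
  have [n nu] : exists n, len u = n by exists (len u).
  elim: n u nu => [|n IH] u lu.
    have := word_length_word Ssym Sgen u; rewrite lu => /is_word_of0 ->.
    by rewrite !(fproj1 hphi) normr0 subrr mulr0.
  have [s [h [Ss lh uE]]] := word_length_gt0 Ssym Sgen lu.
  rewrite lu uE !(fprojM hphi) (le_trans (ler_normD _ _))//.
  have := gS s Ss; have := IH h lh; rewrite lh -natr1; lra.
have gx n : n%:R * `|g (pr x)| <= K * C.
  have [T hT] := (converges_toP _ _ _).1 lim (x ^+ n)%g.
  have := hT T (leqnn T); rewrite psiE word_dist1 (geodesic_length geo g0) => e.
  have g_gamma t : g (pr (gamma t)) = 0.
    elim: t => [|t IH]; first by rewrite g0 (fproj1 hphi).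
    rewrite -(mulVKg (gamma t) (gamma t.+1)) (fprojM hphi) IH add0r; apply: gV.
    have St := geodesic_step Ssym Sgen t geo.
    by exists (step t) => //; split.
  have := gK (x ^- n * gamma T)%g.
  rewrite !(fprojM hphi) !(fprojV hphi) g_gamma facet_path addr0 normrN.
  rewrite (fprojX hphi g) normrM normr_nat => /le_trans; apply.
  apply: ler_wpM2l => //; rewrite -/(word_dist S _ _).
  have := bounded (x ^+ n)%g; rewrite ler_norml => /andP[_]; rewrite -e; lra.
by apply/eqP; rewrite -normr_le0; exact: natmul_bounded gx.
Qed.

(** Some power [h] of an element of the submonoid stabilizes [xi], and [xi]
    equals [- f] at [h]: for large [t], the distance from [h] to [gamma t] is
    the difference of the values of [f], so [h] precedes [gamma t]. *)
Lemma facet_path_dominating : finite_set (orbit xi) -> dominating S phi f gamma.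
Proof.
move=> fin w cw; have xi1 := limit_id lim.
have [k k0 Hk] := finite_orbit_power xi1 fin.
set h := (w ^+ k)%g; have sh : stabilizer xi h by exact: Hk.
have xih : xi h = - f (pr h).
  apply/eqP; rewrite -subr_eq0 opprK -normr_le0; apply: natmul_bounded => n.
  have := bounded (h ^+ n)%g.
  by rewrite stabilizerX// (fprojX hphi) -mulrDr normrM normr_nat; exact.
have [T hT] := (converges_toP _ _ _).1 lim h.
exists T => t /hT; rewrite psiE word_dist1 (geodesic_length geo g0) xih => e.
have ch : cone S phi f (h^-1 * gamma t)%g.
  rewrite /cone /= (fprojM hphi) (fprojV hphi) facet_path -/(word_dist S _ _); lra.
have cX n : cone S phi f (w ^+ n)%g.
  elim: n => [|n IH]; first by rewrite expg0; exact: cone1.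
  by rewrite expgS; exact: coneM.
have := coneM Ssym Sgen hphi fle (cX k.-1) ch.
have -> : h = (w * w ^+ k.-1)%g by rewrite -expgS prednK.
by rewrite invgM -mulgA mulVKg.
Qed.

End Path.

End FiniteOrbitLimit.

(** * The correspondence *)

Section Correspondence.
Local Open Scope ring_scope.
Context {R : realType} {G : groupType} {N : nat} (S : set G) (phi : G -> 'rV[int]_N).
Hypotheses (hG : nilpotent_group G) (finS : finite_set S)
  (Ssym : symmetric_set S) (Sgen : generating_set S)
  (hphi : torsion_free_abelianisation phi).
Local Notation pr := (@Defs.proj R G N phi).
Local Notation len := (word_length S).
Local Notation dist := (word_dist S).
Local Notation P := (@generator_polytope R G N S phi).
Implicit Types (f : {scalar 'rV[R]_N}) (gamma : nat -> G) (xi : G -> R)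
  (x y g : G) (F : set 'rV[R]_N) (O : set (G -> R)).

Let finA := @finite_proj_gen R G N S phi finS.
Let oppA v (h : (pr @` S) v) : (pr @` S) (- v) := opp_proj_gen Ssym hphi h.
Let spA : spanning (pr @` S) := spanning_proj_gen Ssym Sgen hphi.

Local Notation functional := (facet_functional (pr @` S)).

Lemma facet_generatorsE f :
  pr @` (facet_generators S phi f) = (pr @` S) `&` [set v | f v = 1].
Proof.
apply/seteqP; split=> [_ [s [Ss fs] <-]|_ [[s Ss <-] fs]]; last by exists s.
by split => //; exists s.
Qed.

Lemma functional_le f s : functional f -> S s -> f (pr s) <= 1.
Proof. by move=> [fle _ _] Ss; apply: fle; exists s. Qed.

Lemma functional_spanning f : functional f ->
  spanning (pr @` (facet_generators S phi f)).
Proof. by rewrite facet_generatorsE => -[]. Qed.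

Definition functional_face f : set 'rV[R]_N := [set v | P v /\ f v = 1].

Definition facet_orbit F O := exists f xi,
  [/\ functional f, F = functional_face f, cone_horofunction S phi f xi & O = orbit xi].

Lemma facet_has_orbit F : facet P F -> exists O, facet_orbit F O.
Proof.
move=> /(facet_has_functional finA oppA spA) [f ff FE].
have [xi hxi] := cone_horofunction_exists Ssym Sgen hphi f.
by exists (orbit xi), f, xi.
Qed.

Lemma facet_orbit_facet F O : facet_orbit F O -> facet P F.
Proof. by move=> [f [xi [ff -> _ _]]]; exact: functional_facet finA oppA spA _ ff. Qed.

Lemma facet_orbit_realized F O : facet_orbit F O ->
  finite_busemann_orbit S O /\ orbit_of_facet S phi F O.
Proof.
move=> [f [xi [ff -> hxi ->]]].
have fle s := @functional_le f s ff.
have spV := functional_spanning ff.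
have V0 : facet_generators S phi f !=set0.
  by have [_ [_ [[s Ss <-] fs]] _] := ff; exists s.
have xi1 := cone_horofunction_id hxi.
have [gamma [geo dom step path]] := dominating_geodesic hG finS Ssym Sgen hphi fle V0.
have lim := dominating_converges Ssym Sgen hphi fle dom hxi.
split; last first.
  exists gamma; split => //; last by exists xi => //; exact: orbit_refl.
  move=> t; have [St ft] := step t; split => //; apply: sub_hull.
  by exists ((gamma t)^-1 * gamma t.+1)%g.
split.
  exact: (cone_horofunction_finite_orbit hG finS Ssym Sgen hphi fle hxi spV).
exists xi => //; split; last by exists gamma.
apply: converges_to_boundary lim _ => z e.
(* [psi z] is at least [- len z], while [xi] tends to [-oo] along [gamma]. *)
pose t := (len z).+1.
have := (hxi (gamma t)).2 _ (path t).1.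
rewrite -e psiE word_dist1 (path t).2 /word_dist mulVg word_length1// -natr1.
have := ler0n R (len ((gamma t)^-1 * z)%g); lra.
Qed.

Lemma functional_face_inj f f' : functional f ->
  (forall s, S s -> f (pr s) = 1 -> f' (pr s) = 1) ->
  forall v, f v = f' v.
Proof.
move=> ff h; apply: spanning_eq (functional_spanning ff) _.
by move=> _ [s [Ss fs] <-]; rewrite fs h.
Qed.

Lemma facet_orbit_unique F O O' : facet_orbit F O -> facet_orbit F O' -> O = O'.
Proof.
move=> [f [xi [ff FE hxi ->]]] [f' [xi' [ff' FE' hxi' ->]]].
have ee v : f v = f' v.
  apply: functional_face_inj => // s Ss fs.
  have : functional_face f (pr s) by split => //; apply: sub_hull; exists s.
  by rewrite -FE FE' => -[].
suff -> : xi = xi' by [].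
apply: cone_horofunction_unique hxi _ => x; have [[m cm e] h] := hxi' x; split.
  by exists m => //; rewrite /cone /= ee.
by move=> m' cm'; apply: h; rewrite /cone /= -ee.
Qed.

(** Both functionals stay at bounded distance from the opposite of the same
    function, up to a translation. *)
Lemma facet_orbit_injective F F' O : facet_orbit F O -> facet_orbit F' O -> F = F'.
Proof.
move=> [f [xi [ff -> hxi ->]]] [f' [xi' [ff' -> hxi' e]]].
have fle s := @functional_le f s ff; have fle' s := @functional_le f' s ff'.
have [C hC] := cone_horofunction_bounded hG finS Ssym Sgen hphi fle hxi
  (functional_spanning ff).
have [C' hC'] := cone_horofunction_bounded hG finS Ssym Sgen hphi fle' hxi'
  (functional_spanning ff').
have xi1' := cone_horofunction_id hxi'.
have [g _ gE] : orbit xi xi' by rewrite e; exact: orbit_refl.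
pose D := C + C' + `|f (pr g^-1%g) + xi g^-1%g|.
have diff x : `|f (pr x) - f' (pr x)| <= D.
  have := hC (g^-1 * x)%g; have := hC' x.
  rewrite -gE /act (fprojM hphi) /D.
  set a := xi (_ * x)%g; set b := xi _; set c := f (pr g^-1%g).
  rewrite !ler_norml; have := ler_norm (c + b); have := ler_norm (- (c + b)).
  rewrite normrN => h1 h2 /andP[h3 h4] /andP[h5 h6]; apply/andP; split; lra.
have ffe v : f v = f' v.
  apply: (spanning_eq (spanning_range_proj hphi)) => _ [x _ <-].
  apply/eqP; rewrite -subr_eq0 -normr_le0; apply: natmul_bounded => n.
  have := diff (x ^+ n)%g.
  by rewrite !(fprojX hphi) -mulrBr normrM normr_nat; exact.
by apply/seteqP; split=> v [Pv fv]; split => //; rewrite ?ffe// -ffe.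
Qed.

(** A limit with finite orbit is, after translating the path, the horofunction
    of the facet along which the path runs. *)
Lemma finite_orbit_limit gamma xi : geodesic_path S gamma ->
  converges_to S gamma xi -> finite_set (orbit xi) ->
  exists f t0, [/\ functional f,
    facet_orbit (functional_face f) (orbit xi) &
    dominating S phi f (fun t => (gamma t0)^-1 * gamma (t0 + t)%N)%g].
Proof.
move=> geo lim fin.
have shift t0 : [/\ geodesic_path S (fun t => (gamma t0)^-1 * gamma (t0 + t)%N)%g,
    converges_to S (fun t => (gamma t0)^-1 * gamma (t0 + t)%N)%g
      (act (gamma t0)^-1%g xi),
    finite_set (orbit (act (gamma t0)^-1%g xi)) &
    ((gamma t0)^-1 * gamma (t0 + 0)%N)%g = 1%g].
  by split; rewrite ?addn0 ?mulVg ?orbit_act//;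
    [exact: geodesic_shift|exact: limit_shift].
have [geo0 lim0 fin0 id0] := shift 0%N.
have [f [[C hC] fle]] := finite_orbit_functional hG Ssym Sgen hphi lim0 fin0.
have [t0 steps0] := eventually_facet_steps finS Ssym Sgen hphi lim0 geo0 id0 hC fle.
have [geo1 lim1 fin1 id1] := shift t0.
have stepE s t : (((gamma s)^-1 * gamma (s + t)%N)^-1 *
    ((gamma s)^-1 * gamma (s + t.+1)%N) = (gamma (s + t)%N)^-1 * gamma (s + t).+1%N)%g.
  by rewrite invgM invgK mulgA mulgK addnS.
have steps1 t : f (pr (((gamma t0)^-1 * gamma (t0 + t)%N)^-1 *
    ((gamma t0)^-1 * gamma (t0 + t.+1)%N))%g) = 1.
  rewrite stepE; have := steps0 (t0 + t)%N (leq_addr _ _).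
  by rewrite stepE add0n.
have hC1 : exists C1, forall x, `|act (gamma t0)^-1%g xi x + f (pr x)| <= C1.
  set h := gamma t0; set h0 := gamma 0%N in hC.
  have e x : act h^-1%g xi x =
      act h0^-1%g xi (h0^-1 * h * x)%g - act h0^-1%g xi (h0^-1 * h)%g.
    by rewrite /act !invgK -!mulgA !mulVKg; ring.
  set k := (h0^-1 * h)%g in e; exists (C + C) => x.
  have := hC (k * x)%g; have := hC k; rewrite e (fprojM hphi f k) !ler_norml.
  by move=> /andP[h1 h2] /andP[h3 h4]; apply/andP; split; lra.
have {hC1} [C1 hC1] := hC1.
have dom := facet_path_dominating Ssym Sgen hphi lim1 geo1 id1 hC1 fle steps1 fin1.
have sp := facet_steps_spanning finS Ssym Sgen hphi lim1 geo1 id1 hC1 fle steps1.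
have ff : functional f.
  split; last by rewrite -facet_generatorsE.
    by move=> _ [s Ss <-]; exact: fle.
  have St := geodesic_step Ssym Sgen 0%N geo1.
  eexists; split; last exact: steps1 0%N.
  by eexists; [exact: St|].
exists f, t0; split => //.
exists f, (act (gamma t0)^-1%g xi); split => //; last by rewrite orbit_act.
have [xi' hxi'] := cone_horofunction_exists Ssym Sgen hphi f.
suff -> : act (gamma t0)^-1%g xi = xi' by [].
have := dominating_converges Ssym Sgen hphi fle dom hxi'.
move=> /converges_toP cvg'; move: lim1 => /converges_toP cvg1; apply/funext => x.
have [T hT] := cvg1 x; have [T' hT'] := cvg' x.
by rewrite -(hT (maxn T T')) ?leq_maxl// hT'// leq_maxr.
Qed.

Lemma finite_busemann_facet_orbit O : finite_busemann_orbit S O ->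
  exists F, facet_orbit F O.
Proof.
move=> [finO [xi [_ [gamma geo lim]] OE]]; rewrite OE in finO *.
by have [f [t0 [_ h _]]] := finite_orbit_limit geo lim finO; exists (functional_face f).
Qed.

(** Suppose that the path runs along [F], and let [v] be a generator in the facet
    attached to its limit. Removing [v] from the front of the point reached at a
    late time [T] leaves an element of length [T - 1], where the functional of [F]
    is at most [T - 1], against [T] before: so it is 1 at [v]. Thus the two
    facets have the same functional. *)
Lemma orbit_of_facet_facet_orbit F O : facet P F -> finite_busemann_orbit S O ->
  orbit_of_facet S phi F O -> facet_orbit F O.
Proof.
move=> /(facet_has_functional finA oppA spA) [f ff ->] [finO [xi0 bxi0 OE]].
move=> [gamma [geo stepF [xi Oxi lim]]].
have OE' : O = orbit xi by rewrite OE in Oxi *; rewrite (orbit_eq Oxi).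
rewrite OE' in finO *.
have [f' [t0 [ff' h dom]]] := finite_orbit_limit geo lim finO.
suff e : forall v, f' v = f v.
  move: h; congr facet_orbit.
  by apply/seteqP; split=> v [Pv fv]; split; rewrite // -fv e.
apply: functional_face_inj => // v Sv fv.
have fle s := @functional_le f s ff; have fle' s := @functional_le f' s ff'.
have cv : cone S phi f' v by apply: facet_generators_cone.
have lv : len v = 1%N by apply: (facet_generators_length Ssym Sgen hphi fle').
have [T hT] := dom v cv; pose u := ((gamma t0)^-1 * gamma (t0 + T)%N)%g.
have cu : cone S phi f' (v^-1 * u)%g by exact: hT.
have lu : len u = T.
  by rewrite /u -/(word_dist S _ _) geodesic_dist ?leq_addr// addKn.
have fu : f (pr u) = T%:R.
  rewrite /u; elim: (T) => [|k IH]; first by rewrite addn0 mulVg (fproj1 hphi).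
  rewrite addnS -(mulVKg (gamma (t0 + k)%N) (gamma (t0 + k).+1)) mulgA (fprojM hphi) IH.
  by have [_ ->] := stepF (t0 + k)%N; rewrite natr1.
have := functional_le_length Ssym Sgen hphi fle (v^-1 * u)%g.
have := cone_length Ssym Sgen hphi fle' cv cu; rewrite mulVKg lu lv => TE.
rewrite (fprojM hphi) (fprojV hphi) fu {1}TE natrD => h'.
by apply/le_anti; rewrite fle//=; lra.
Qed.

End Correspondence.

Theorem theorem1p1 (R : realType) (G : groupType) (S : set G)
    (N : nat) (phi : G -> 'rV[int]_N)
    (hG : nilpotent_group G)
    (hSfin : finite_set S) (hSsym : symmetric_set S) (hSgen : generating_set S)
    (hphi : torsion_free_abelianisation phi) :
  exists theta : set 'rV[R]_N -> set (G -> R),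
    set_bij (facet (generator_polytope S phi)) (finite_busemann_orbit S) theta
    /\ forall F O, facet (generator_polytope S phi) F ->
         finite_busemann_orbit S O ->
         (theta F = O <-> orbit_of_facet S phi F O).
Proof.
pose Q (F : set 'rV[R]_N) (O : set (G -> R)) :=
  facet (generator_polytope S phi) F -> facet_orbit S phi F O.
have /choice[theta hth] : forall F, exists O, Q F O.
  move=> F; have [fF|nF] := pselect (facet (generator_polytope S phi) F).
    by have [U hU] := facet_has_orbit hSfin hSsym hSgen hphi fF; exists U.
  by exists set0.
exists theta; split; [split|].
- move=> F fF; exact: (facet_orbit_realized hG hSfin hSsym hSgen hphi (hth F fF)).1.
- move=> F F' /set_mem fF /set_mem fF' e.
  apply: (facet_orbit_injective hG hSfin hSsym hSgen hphi (hth F fF)).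
  by rewrite e; exact: hth.
- move=> O fO; have [F hF] := finite_busemann_facet_orbit hG hSfin hSsym hSgen hphi fO.
  have fF := facet_orbit_facet hSfin hSsym hSgen hphi hF.
  by exists F => //; exact: facet_orbit_unique (hth F fF) hF.
move=> F O fF fO; split=> [<-|h].
  exact: (facet_orbit_realized hG hSfin hSsym hSgen hphi (hth F fF)).2.
apply: facet_orbit_unique (hth F fF) _.
exact: orbit_of_facet_facet_orbit.
Qed.
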